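(* A Banach Lie algebra $\mathcal{L}$ belongs to $\mathbf{Sem}(P_{\mathfrak{S}^{\max}})$ if and only if there is a bounded isomorphism $\theta$ from $\mathcal{L}$ onto a subdirect product of some family of subsimple Lie algebras. It belongs to $\mathbf{Sem}(P_{\mathfrak{J}^{\max}})$ (respectively, to $\mathbf{Sem}(P_{\mathfrak{J}})$) if and only if there is a bounded isomorphism from $\mathcal{L}$ onto a subdirect product of some family of simple finite-dimensional or one-dimensional (respectively, finite-dimensional) Lie algebras.
   Context: A Banach Lie algebra is a complex Lie algebra $\mathcal{L}$ which is a Banach space in some norm such that, for some constant $t_{\mathcal{L}}>0$ (a multiplication constant), $\|[a,b]\|\leq t_{\mathcal{L}}\|a\|\|b\|$ for all $a,b\in\mathcal{L}$. Finite-dimensional complex Lie algebras with arbitrary norms are Banach Lie algebras. $P_{\mathfrak{S}^{\max}}(\mathcal{L})$ (respectively $P_{\mathfrak{J}^{\max}}(\mathcal{L})$, $P_{\mathfrak{J}}(\mathcal{L})$) is the intersection of all maximal proper closed Lie subalgebras of finite codimension (respectively, of all maximal proper closed Lie ideals of finite codimension, of all proper closed Lie ideals of finite codimension) in $\mathcal{L}$, and is $\mathcal{L}$ if there are none. For $R$ one of these, $\mathbf{Sem}(R)$ is the class of Banach Lie algebras $\mathcal{L}$ with $R(\mathcal{L})=\{0\}$. (Algebras in $\mathbf{Sem}(P_{\mathfrak{S}^{\max}})$ are called Frattini-free.) A finite-dimensional (complex) Lie algebra $\mathcal{L}$ is subsimple if either $\dim\mathcal{L}=1$ or it has a proper maximal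 Lie subalgebra that contains no non-zero Lie ideals of $\mathcal{L}$. Let $\{\mathcal{L}_{\lambda}\}_{\lambda\in\Lambda}$ be Banach Lie algebras with multiplication constants $t_\lambda$ satisfying $\sup_\lambda t_{\lambda}<\infty$. Their normed direct product $\oplus_{\Lambda}\mathcal{L}_{\lambda}$ is the Banach Lie algebra of all families $a=(a_{\lambda})_{\lambda\in\Lambda}$, $a_\lambda\in\mathcal{L}_\lambda$, with $\|a\|=\sup_\lambda\|a_{\lambda}\|<\infty$, with coordinatewise operations. For $\mu\in\Lambda$ let $\psi_{\mu}((a_{\lambda}))=a_{\mu}$. A Lie subalgebra $\mathcal{M}$ (not necessarily closed) of $\oplus_{\Lambda}\mathcal{L}_{\lambda}$ is a subdirect product of the algebras $\{\mathcal{L}_{\lambda}\}_{\lambda\in\Lambda}$ if $\psi_{\mu}(\mathcal{M})=\mathcal{L}_{\mu}$ for each $\mu\in\Lambda$. A bounded isomorphism onto $\mathcal{M}$ means a bounded injective Lie homomorphism with image $\mathcal{M}$ (its inverse is not required to be bounded). *)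

(* Defs.v *)
From HB Require Import structures.
From mathcomp Require Import all_boot all_order all_algebra.
From mathcomp Require Import complex.
From mathcomp Require Import all_classical all_reals all_analysis.

Set Implicit Arguments.
Unset Strict Implicit.
Unset Printing Implicit Defensive.

Import Order.TTheory GRing.Theory Num.Theory.
Import numFieldNormedType.Exports.

Local Open Scope classical_set_scope.
Local Open Scope ring_scope.
Local Open Scope complex_scope.

(* Norms of complex normed modules take values in R[i]; an inequality
   [x <= y] in R[i] implies that [y - x] is real. *)

HB.mixin Record isBanachLie (R : realType) L & CompleteNormedModule R[i] L := {
  lie : L -> L -> L;
  lie_linearl : forall c a a' b, lie (c *: a + a') b = c *: lie a b + lie a' b;
  lie_linearr : forall c a b b', lie a (c *: b + b') = c *: lie a b + lie a b';
  liexx : forall a, lie a a = 0;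
  lie_jacobi : forall a b c,
    lie a (lie b c) + lie b (lie c a) + lie c (lie a b) = 0;
  lie_bounded : exists2 t : R, 0 < t &
    forall a b, `|lie a b| <= t%:C * `|a| * `|b|
}.

#[short(type="banachLieType")]
HB.structure Definition BanachLie (R : realType) :=
  {L of isBanachLie R L & CompleteNormedModule R[i] L}.

Definition mult_constant (R : realType) (L : banachLieType R) (t : R) : Prop :=
  0 < t /\ forall a b : L, `|lie a b| <= t%:C * `|a| * `|b|.

Section Subspaces.
Context {R : realType} {L : banachLieType R}.
Implicit Types M N I : set L.

Definition subspace_of M : Prop :=
  M 0 /\ forall (c : R[i]) a b, M a -> M b -> M (c *: a + b).

Definition lie_subalgebra M : Prop :=
  subspace_of M /\ forall a b, M a -> M b -> M (lie a b).

Definition lie_ideal M : Prop :=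
  subspace_of M /\ forall a b, M b -> M (lie a b).

Definition proper_set M : Prop := M <> setT.

(* The classes of [v 0], ..., [v (n - 1)] form a basis of the quotient L/M. *)
Definition has_codim M (n : nat) : Prop :=
  exists v : 'I_n -> L, forall x : L,
    exists! c : 'rV[R[i]]_n, M (x - \sum_(i < n) c ord0 i *: v i).

Definition finite_codim M : Prop := exists n, has_codim M n.

Definition maximal_in (S : set (set L)) M : Prop :=
  S M /\ forall N, S N -> M `<=` N -> N = M.

End Subspaces.

Section Classes.
Context {R : realType}.

Definition has_dim (L : banachLieType R) (n : nat) : Prop :=
  has_codim ([set 0] : set L) n.

(* On a finite-dimensional algebra completeness, closedness of subspaces and
   boundedness of the bracket are automatic, so the [banachLieType]s with
   [finite_dim] are the finite-dimensional Lie algebras with arbitrary norms. *)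
Definition finite_dim (L : banachLieType R) : Prop := exists n, has_dim L n.

Definition closed_subalgebras_fc (L : banachLieType R) : set (set L) :=
  [set M | [/\ lie_subalgebra M, closed M, proper_set M & finite_codim M]].

Definition closed_ideals_fc (L : banachLieType R) : set (set L) :=
  [set M | [/\ lie_ideal M, closed M, proper_set M & finite_codim M]].

(* [\bigcap] over an empty family is [setT], i.e. the whole of [L]. *)
Definition P_Smax (L : banachLieType R) : set L :=
  \bigcap_(M in maximal_in (@closed_subalgebras_fc L)) M.

Definition P_Jmax (L : banachLieType R) : set L :=
  \bigcap_(M in maximal_in (@closed_ideals_fc L)) M.

Definition P_J (L : banachLieType R) : set L :=
  \bigcap_(M in @closed_ideals_fc L) M.

Definition Sem (P : forall L : banachLieType R, set L) (L : banachLieType R) :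
  Prop := P L = [set 0].

Definition subsimple (L : banachLieType R) : Prop :=
  finite_dim L /\
  (has_dim L 1 \/
   exists2 M : set L,
     maximal_in [set N | lie_subalgebra N /\ proper_set N] M &
     forall I : set L, lie_ideal I -> I `<=` M -> I = [set 0]).

(* Non-abelian, so that one-dimensional algebras are not simple. *)
Definition lie_simple (L : banachLieType R) : Prop :=
  (exists a b : L, lie a b <> 0) /\
  forall I : set L, lie_ideal I -> I = [set 0] \/ I = setT.

End Classes.

Record banachLieFamily (R : realType) := BanachLieFamily {
  fam_index : Type;
  fam_alg :> fam_index -> banachLieType R;
  fam_bound : exists t : fam_index -> R,
    (forall l, mult_constant (fam_alg l) (t l)) /\ has_ubound (range t)
}.

Section NormedDirectProduct.
Context {R : realType} (F : banachLieFamily R).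
Local Notation Lam := (fam_index F).

Record dprod := DProd {
  dcoord : forall l : Lam, F l;
  dcoord_bounded : exists M : R, forall l, `|dcoord l| <= M%:C
}.

Lemma dprod_eq (a b : dprod) : (forall l, dcoord a l = dcoord b l) -> a = b.
Proof.
case: a b => [a pa] [b pb] /= ab.
have {}ab : a = b by apply: functional_extensionality_dep.
by case: _ / ab pb => pb; congr DProd; exact: Prop_irrelevance.
Qed.

Lemma normRe (V : normedZmodType R[i]) (x : V) : `|x| = (complex.Re `|x|)%:C.
Proof. by rewrite RRe_real// normr_real. Qed.

Lemma dadd_subproof (a b : dprod) :
  exists M : R, forall l, `|dcoord a l + dcoord b l| <= M%:C.
Proof.
case: a b => [a [A pA]] [b [B pB]]; exists (A + B) => l /=.
by rewrite rmorphD/= (le_trans (ler_normD _ _))// lerD.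
Qed.

Lemma dscale_subproof (c : R[i]) (a : dprod) :
  exists M : R, forall l, `|c *: dcoord a l| <= M%:C.
Proof.
case: a => [a [A pA]]; exists (complex.Re `|c| * A) => l /=.
by rewrite normrZ rmorphM; exact: ler_wpM2l (normr_ge0 c) _ _ (pA l).
Qed.

Lemma dzero_subproof : exists M : R, forall l, `|0 : F l| <= M%:C.
Proof. by exists 0 => l; rewrite normr0. Qed.

Lemma dopp_subproof (a : dprod) :
  exists M : R, forall l, `|- dcoord a l| <= M%:C.
Proof. by case: a => [a [A pA]]; exists A => l /=; rewrite normrN. Qed.

Lemma dlie_subproof (a b : dprod) :
  exists M : R, forall l, `|lie (dcoord a l) (dcoord b l)| <= M%:C.
Proof.
have [t [ht [T hT]]] := fam_bound F.
case: a b => [a [A pA]] [b [B pB]]; exists (T * A * B) => l /=.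
have [t0 htl] := ht l; apply: (le_trans (htl _ _)).
have tT : t l <= T by apply: hT; exists l.
rewrite !rmorphM/= ler_pM// ?mulr_ge0 ?ler0c ?(ltW t0)//.
by rewrite ler_pM// ?ler0c ?(ltW t0)// lecR.
Qed.

Definition dadd a b := DProd (dadd_subproof a b).
Definition dscale c a := DProd (dscale_subproof c a).
Definition dzero := DProd dzero_subproof.
Definition dopp a := DProd (dopp_subproof a).
Definition dlie a b := DProd (dlie_subproof a b).
Definition dnorm (a : dprod) : R[i] :=
  (sup (range (fun l => complex.Re `|dcoord a l|)))%:C.

HB.instance Definition _ := gen_eqMixin dprod.
HB.instance Definition _ := gen_choiceMixin dprod.

Lemma daddA : associative dadd.
Proof. by move=> a b c; apply: dprod_eq => l /=; rewrite addrA. Qed.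
Lemma daddC : commutative dadd.
Proof. by move=> a b; apply: dprod_eq => l /=; rewrite addrC. Qed.
Lemma dadd0 : left_id dzero dadd.
Proof. by move=> a; apply: dprod_eq => l /=; rewrite add0r. Qed.
Lemma daddN : left_inverse dzero dopp dadd.
Proof. by move=> a; apply: dprod_eq => l /=; rewrite addNr. Qed.

HB.instance Definition _ :=
  GRing.isZmodule.Build dprod daddA daddC dadd0 daddN.

Lemma dscaleA c d a : dscale c (dscale d a) = dscale (c * d) a.
Proof. by apply: dprod_eq => l /=; rewrite scalerA. Qed.
Lemma dscale1 : left_id 1 dscale.
Proof. by move=> a; apply: dprod_eq => l /=; rewrite scale1r. Qed.
Lemma dscaleDr : right_distributive dscale +%R.
Proof. by move=> c a b; apply: dprod_eq => l /=; rewrite scalerDr. Qed.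
Lemma dscaleDl a : {morph dscale^~ a : c d / c + d}.
Proof. by move=> c d; apply: dprod_eq => l /=; rewrite scalerDl. Qed.

HB.instance Definition _ :=
  GRing.Zmodule_isLmodule.Build R[i] dprod dscaleA dscale1 dscaleDr dscaleDl.

Lemma le_coord_dnorm (a : dprod) l : `|dcoord a l| <= dnorm a.
Proof.
rewrite /dnorm normRe lecR; apply: ub_le_sup; last by exists l.
have [M hM] := dcoord_bounded a.
by exists M => _ [k _ <-]; rewrite -lecR -normRe hM.
Qed.

Lemma dnorm_ge0 (a : dprod) : 0 <= dnorm a.
Proof.
have [[l]|E] := pselect (inhabited Lam).
  exact: le_trans (normr_ge0 _) (le_coord_dnorm a l).
rewrite /dnorm [X in sup X](_ : _ = set0) ?sup0//.
by rewrite -subset0 => x [l _ _]; apply: E; split.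
Qed.

Lemma dnorm_le (a : dprod) (M : R) :
  0 <= M -> (forall l, `|dcoord a l| <= M%:C) -> dnorm a <= M%:C.
Proof.
move=> M0 hM; have [[l0]|E] := pselect (inhabited Lam).
  rewrite /dnorm lecR; apply: ge_sup; first by exists (complex.Re `|dcoord a l0|), l0.
  by move=> _ [l _ <-]; rewrite -lecR -normRe hM.
rewrite /dnorm [X in sup X](_ : _ = set0) ?sup0 ?lecR//.
by rewrite -subset0 => x [l _ _]; apply: E; split.
Qed.

Lemma dnorm_leC (a : dprod) (M : R[i]) :
  0 <= M -> (forall l, `|dcoord a l| <= M) -> dnorm a <= M.
Proof.
move=> M0; have -> : M = (complex.Re M)%:C by rewrite RRe_real// ger0_real.
by move=> hM; apply: dnorm_le => //; rewrite -ler0c RRe_real// ger0_real.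
Qed.

Lemma dnormD a b : dnorm (a + b) <= dnorm a + dnorm b.
Proof.
apply: dnorm_leC => [|l]; first by rewrite addr_ge0 ?dnorm_ge0.
by rewrite (le_trans (ler_normD _ _))// lerD ?le_coord_dnorm.
Qed.

Lemma dnorm_scale_le (c : R[i]) a : dnorm (c *: a) <= `|c| * dnorm a.
Proof.
apply: dnorm_leC => [|l]; first by rewrite mulr_ge0 ?dnorm_ge0.
by rewrite normrZ ler_wpM2l ?le_coord_dnorm.
Qed.

Lemma dnormZ (c : R[i]) a : dnorm (c *: a) = `|c| * dnorm a.
Proof.
apply/eqP; rewrite eq_le dnorm_scale_le/=.
have [->|c0] := eqVneq c 0; first by rewrite normr0 mul0r dnorm_ge0.
rewrite -[in leLHS](scale1r a) -(mulVf c0) -scalerA.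
rewrite -ler_pdivlMl ?normr_gt0// -normfV.
exact: dnorm_scale_le.
Qed.

Lemma dnorm0_eq0 a : dnorm a = 0 -> a = 0.
Proof.
move=> a0; apply: dprod_eq => l /=; apply/eqP.
by rewrite -normr_le0 -a0 le_coord_dnorm.
Qed.

HB.instance Definition _ :=
  @Lmodule_isNormed.Build R[i] dprod dnorm dnormD dnormZ dnorm0_eq0.

Lemma le_coord_norm (a : dprod) l : `|dcoord a l| <= `|a|.
Proof. exact: le_coord_dnorm. Qed.

Lemma dprod_complete (G : set_system dprod) :
  ProperFilter G -> cauchy G -> cvg G.
Proof.
move=> GG Gc.
have Gl l : cvg (dcoord^~ l @ G).
  apply: cauchy_cvg; apply/cauchy_ballP => e e0.
  rewrite near_map2; move/cauchy_ballP : Gc => /(_ e e0).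
  apply: filterS => -[a b] /=.
  rewrite -!ball_normE /= => ab; apply: le_lt_trans ab.
  exact: (le_coord_norm (a - b) l).
pose lm l := lim (dcoord^~ l @ G).
have Gu (e : R[i]) : 0 < e ->
    \forall a \near G, forall l, `|lm l - dcoord a l| <= e.
  move=> e0; have e20 : 0 < e / 2 by rewrite divr_gt0.
  near=> a => l; near G => b.
  rewrite -(subrKA (dcoord b l)) (le_trans (ler_normD _ _))//.
  rewrite (splitr e) lerD//.
    by near: b; move/cvgrPdist_le : (Gl l) => /(_ _ e20).
  rewrite (le_trans (le_coord_norm (b - a) l))// distrC ltW//.
  near: b; near: a; apply: nearP_dep.
  move/cauchy_ballP : Gc => /(_ _ e20); apply: filterS => -[x y] /=.
  by rewrite -ball_normE.
have lmb : exists M : R, forall l, `|lm l| <= M%:C.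
  have [a ha] := @filter_ex _ G _ _ (Gu 1 ltr01).
  have [M hM] := dcoord_bounded a; exists (1 + M) => l.
  rewrite -(subrK (dcoord a l) (lm l)) rmorphD.
  exact: le_trans (ler_normD _ _) (lerD (ha l) (hM l)).
apply/cvg_ex; exists (DProd lmb); apply/cvgrPdist_le => e e0.
apply: filterS (Gu e e0) => a ha; apply: dnorm_leC => //; exact: ltW.
Unshelve. all: by end_near. Qed.

HB.instance Definition _ := Uniform_isComplete.Build dprod dprod_complete.

Lemma dlie_linearl (c : R[i]) (a a' b : dprod) :
  dlie (c *: a + a') b = c *: dlie a b + dlie a' b.
Proof. by apply: dprod_eq => l /=; rewrite lie_linearl. Qed.
Lemma dlie_linearr (c : R[i]) (a b b' : dprod) :
  dlie a (c *: b + b') = c *: dlie a b + dlie a b'.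
Proof. by apply: dprod_eq => l /=; rewrite lie_linearr. Qed.
Lemma dliexx (a : dprod) : dlie a a = 0.
Proof. by apply: dprod_eq => l /=; rewrite liexx. Qed.
Lemma dlie_jacobi (a b c : dprod) :
  dlie a (dlie b c) + dlie b (dlie c a) + dlie c (dlie a b) = 0.
Proof. by apply: dprod_eq => l /=; rewrite lie_jacobi. Qed.
Lemma dlie_bounded : exists2 t : R, 0 < t &
  forall a b : dprod, `|dlie a b| <= t%:C * `|a| * `|b|.
Proof.
have [t [ht [T hT]]] := fam_bound F.
exists (Num.max T 1) => [|a b]; first by rewrite lt_max ltr01 orbT.
have m0 : 0 <= (Num.max T 1)%:C :> R[i] by rewrite ler0c le_max ler01 orbT.
apply: dnorm_leC => [|l]; first by rewrite !mulr_ge0.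
have [t0 htl] := ht l; apply: (le_trans (htl _ _)).
rewrite ler_pM ?le_coord_norm ?mulr_ge0 ?ler0c ?(ltW t0)//.
rewrite ler_pM ?le_coord_norm ?ler0c ?(ltW t0)//.
by rewrite lecR le_max hT//; exists l.
Qed.

HB.instance Definition _ := isBanachLie.Build R dprod
  dlie_linearl dlie_linearr dliexx dlie_jacobi dlie_bounded.

Definition dproj (l : Lam) (a : dprod) : F l := dcoord a l.

Definition subdirect_product (M : set dprod) : Prop :=
  lie_subalgebra M /\ forall l, dproj l @` M = setT.

End NormedDirectProduct.

(* The inverse of [theta] on [M] need not be bounded. *)
Definition bounded_iso_onto (R : realType) (L L' : banachLieType R)
    (theta : {linear L -> L'}) (M : set L') : Prop :=
  [/\ exists K : R, forall x, `|theta x| <= K%:C * `|x|,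
      forall x y, theta (lie x y) = lie (theta x) (theta y),
      injective theta
    & range theta = M].

Definition iso_to_subdirect_product_of (R : realType)
    (Q : banachLieType R -> Prop) (L : banachLieType R) : Prop :=
  exists F : banachLieFamily R, (forall l, Q (F l)) /\
    exists M : set (dprod F), subdirect_product M /\
      exists theta : {linear L -> dprod F}, bounded_iso_onto theta M.

(* Main.v *)
(* For the Frattini-free case, everything rests on [largest_ideal]: the largest
   ideal contained in a maximal closed subalgebra [M] of finite codimension of
   [L] again has finite codimension.  If every [x] in [M] acts nilpotently on
   [L / M], Engel's theorem makes [M] itself an ideal.  Otherwise some [a]
   outside [M] satisfies [x, a] = lam a modulo [M] with [lam <> 0].
   Weisfeiler's filtration starting from the [M]-module generated by [a] has
   graded pieces on which the eigenvalues of [ad x] are bounded by the norm of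
   [ad x], so [ad a], which shifts them by [lam], is nilpotent on the graded
   algebra.  The elements of the lowest nonzero degree commute on it; those
   acting nilpotently form an [M]-submodule containing the brackets with [a],
   hence are everything, and induction on the depth shows that the whole
   negative part acts nilpotently.  By transitivity the filtration is
   stationary, and its last term is the ideal sought.  The theorem follows by
   mapping [L] to the product of its quotients by such ideals.

   Conversely, in a subsimple algebra the intersection of the maximal
   subalgebras is stable under the exponentials of ad-nilpotent derivations,
   hence under the ideal generated by the root spaces of some [ad x] (or under
   everything, if all [ad x] are nilpotent); the largest subspace of a core-free
   maximal subalgebra that is stable under this ideal is an ideal, so it is
   zero. *)

Require Import Defs.
From HB Require Import structures.
From mathcomp Require Import all_boot all_order all_algebra.
From mathcomp Require Import complex lra zify.
From mathcomp Require Import all_classical all_reals all_analysis.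

Set Implicit Arguments.
Unset Strict Implicit.
Unset Printing Implicit Defensive.

Import Order.TTheory GRing.Theory Num.Theory.
Import numFieldNormedType.Exports.

Local Open Scope classical_set_scope.
Local Open Scope ring_scope.
Local Open Scope complex_scope.

(** * Subspaces of finite codimension *)

Section Subspaces.
Context {K : fieldType} {X : lmodType K}.
Implicit Types (M N S E F Y Z : set X) (T : X -> X).

(** [L] may be infinite-dimensional, so no trace or Killing form is at hand, and a priori the
    filtration below [M] could descend forever through finite-dimensional pieces. The norm enters
    this argument through one estimate: modulo a closed subspace stable under [ad x], every
    eigenvalue of [ad x] has modulus at most [t * rnorm x], with [t] a multiplication constant. The
    bound does not depend on the subspace, so a single exponent of nilpotency of [ad a] serves all
    graded pieces at once. Stationarity is a count: if every product of [K] brackets of degree [- 1]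
    vanishes on the graded algebra, a nonzero class of degree [K] would, by transitivity, survive
    some [K] such brackets; hence there is none. Quotients are avoided in all of this: an action on
    [V / W] is given by operators preserving [V] and [W], with equations holding modulo [W], and the
    graded algebra becomes an algebra of operators on families indexed by [int]. Characteristic zero
    allows division by the coefficient in the derivative [p * c ^ (p - 1) * d] of [c ^ p]. *)

Definition subsp M :=
  M 0 /\ forall (c : K) a b, M a -> M b -> M (c *: a + b).

Lemma subsp0 M : subsp M -> M 0. Proof. by case. Qed.

Lemma subspL M c a b : subsp M -> M a -> M b -> M (c *: a + b).
Proof. by case=> _; apply. Qed.

Lemma subspD M a b : subsp M -> M a -> M b -> M (a + b).
Proof. by case=> _ h Ma Mb; rewrite -[a]scale1r; exact: h. Qed.

Lemma subspZ M c a : subsp M -> M a -> M (c *: a).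
Proof. by case=> h0 h Ma; rewrite -[_ *: _]addr0; exact: h. Qed.

Lemma subspN M a : subsp M -> M a -> M (- a).
Proof. by move=> h Ma; rewrite -scaleN1r; exact: subspZ. Qed.

Lemma subspB M a b : subsp M -> M a -> M b -> M (a - b).
Proof. by move=> h Ma Mb; apply: subspD => //; exact: subspN. Qed.

Lemma subsp_sum M (I : Type) (r : seq I) (P : pred I) (f : I -> X) :
  subsp M -> (forall i, P i -> M (f i)) -> M (\sum_(i <- r | P i) f i).
Proof.
move=> hM h; elim/big_ind: _ => //; [exact: subsp0|by move=> *; exact: subspD].
Qed.

Lemma subspDl M a b : subsp M -> M a -> M (a + b) -> M b.
Proof. by move=> h Ma Mab; rewrite -(addKr a b) addrC; exact: subspB. Qed.

Lemma subspZ_inv M (c : K) a : c != 0 -> subsp M -> M (c *: a) -> M a.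
Proof.
by move=> c0 hM h; rewrite -(scale1r a) -(mulVf c0) -scalerA; exact: subspZ.
Qed.

Lemma subspT : subsp [set: X]. Proof. by []. Qed.

Lemma subsp_set0 : subsp [set 0 : X].
Proof. by split=> // c a b -> ->; rewrite scaler0 addr0. Qed.

Lemma subspI M N : subsp M -> subsp N -> subsp (M `&` N).
Proof.
move=> hM hN; split; first by split; exact: subsp0.
by move=> c a b [? ?] [? ?]; split; [case: hM|case: hN] => _; apply.
Qed.

Definition islin (Y : lmodType K) (T : X -> Y) :=
  forall (c : K) a b, T (c *: a + b) = c *: T a + T b.

Definition adj M v : set X := [set x | exists c : K, M (x - c *: v)].

Lemma subsp_adj M v : subsp M -> subsp (adj M v).
Proof.
move=> hM; split; first by exists 0; rewrite scale0r subr0; exact: subsp0.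
move=> c a b [p Mp] [q Mq]; exists (c * p + q).
rewrite scalerDl opprD -scalerA addrACA -scalerBr.
by case: hM => _; apply.
Qed.

Lemma sub_adj M v : M `<=` adj M v.
Proof. by move=> x Mx; exists 0; rewrite scale0r subr0. Qed.

Lemma adj_gen M v : subsp M -> adj M v v.
Proof. by move=> hM; exists 1; rewrite scale1r subrr; exact: subsp0. Qed.

Lemma adj_mono M M' v : M `<=` M' -> adj M v `<=` adj M' v.
Proof. by move=> h x [c hc]; exists c; exact: h. Qed.

Lemma adj_sub M v S : subsp S -> M `<=` S -> S v -> adj M v `<=` S.
Proof.
move=> hS MS Sv x [c Mx]; rewrite -(subrK (c *: v) x).
by apply: subspD => //; [exact: MS|exact: subspZ].
Qed.

(* [S] is contained in [M] plus the span of [n] vectors, so that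
   [dim (S / M) <= n] when [M `<=` S]. *)
Fixpoint cod (n : nat) M S : Prop :=
  if n is n'.+1 then exists v, cod n' (adj M v) S else S `<=` M.

Lemma codS n M S : cod n.+1 M S = exists v, cod n (adj M v) S.
Proof. by []. Qed.

Lemma cod_sub n M M' S S' :
  M `<=` M' -> S' `<=` S -> cod n M S -> cod n M' S'.
Proof.
move=> MM' SS'; elim: n M M' MM' => [|n IH] M M' MM' /=.
  by move=> SM x /SS' /SM /MM'.
by case=> v h; exists v; apply: IH h; exact: adj_mono.
Qed.

Lemma cod_trans n m M N S : cod n M N -> cod m N S -> cod (n + m) M S.
Proof.
elim: n M => [|n IH] M /=; first by move=> NM; exact: (cod_sub NM (@subset_refl _ S)).
by case=> v h1 h2; exists v; exact: IH.
Qed.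

Lemma cod_strict n M h S u : subsp M -> subsp h -> M `<=` h ->
  h u -> ~ M u -> S u -> cod n.+1 M S -> cod n h S.
Proof.
elim: n M h => [|n IH] M h hM hh Mh hu nMu Su; rewrite codS => -[v].
  move=> /= SM; have [c Mc] := SM _ Su.
  have c0 : c != 0 by apply/eqP => c0; apply: nMu; rewrite c0 scale0r subr0 in Mc.
  have hv : h v.
    apply: (@subspZ_inv _ c) => //; rewrite -(subKr u (c *: v)).
    by apply: subspB => //; exact: Mh.
  by move=> x /SM; apply: adj_sub.
have [[c Mc]|nu] := pselect (adj M v u).
  have c0 : c != 0 by apply/eqP => c0; apply: nMu; rewrite c0 scale0r subr0 in Mc.
  have hv : h v.
    apply: (@subspZ_inv _ c) => //; rewrite -(subKr u (c *: v)).
    by apply: subspB => //; exact: Mh.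
  by apply: cod_sub; [exact: adj_sub|].
move=> H; exists v; apply: (IH (adj M v)) => //.
- exact: subsp_adj.
- exact: subsp_adj.
- exact: adj_mono.
- exact: sub_adj.
Qed.

(** Induction along a flag from [F] to [E]. The step chooses the vector to adjoin, because in
    several applications only special vectors, such as eigenvectors or vectors killed by a nilpotent
    action, preserve [P]. *)
Lemma cod_ind (P : set X -> Prop) n F E : subsp F -> subsp E -> F `<=` E ->
  cod n F E -> P F ->
  (forall h, subsp h -> F `<=` h -> h `<=` E -> P h -> (exists2 u, E u & ~ h u) ->
     exists u, [/\ E u, ~ h u & P (adj h u)]) ->
  P E.
Proof.
move=> hF hE FE cFE PF step.
suff: forall m h, cod m h E -> subsp h -> F `<=` h -> h `<=` E -> P h -> P E.
  by move=> /(_ n F); apply.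
elim=> [|m IH] h ch hh Fh hE' Ph.
  by rewrite (_ : E = h) //; apply/seteqP; split.
have [Eh|/existsNP[u /not_implyP[Eu nhu]]] := pselect (E `<=` h).
  by rewrite (_ : E = h) //; apply/seteqP; split.
have [w [Ew nhw Pw]] := step h hh Fh hE' Ph (ex_intro2 _ _ u Eu nhu).
apply: (IH (adj h w)) => //.
- apply: (@cod_strict m h _ E w) => //.
  + exact: subsp_adj.
  + exact: sub_adj.
  + exact: adj_gen.
- exact: subsp_adj.
- by move=> x /Fh; exact: sub_adj.
- exact: adj_sub.
Qed.

Lemma homo_chain (D : nat -> set X) i j : (forall i, D i `<=` D i.+1) ->
  (i <= j)%N -> D i `<=` D j.
Proof.
move=> Dinc /subnKC <-; elim: (j - i)%N => [|k IH]; first by rewrite addn0.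
by rewrite addnS => x /IH /Dinc.
Qed.

Lemma subsp_chain (D : nat -> set X) : (forall i, subsp (D i)) ->
  (forall i, D i `<=` D i.+1) -> subsp [set x | exists i, D i x].
Proof.
move=> hD Dinc; split; first by exists 0%N; exact: subsp0.
move=> c a b [i Da] [j Db]; exists (maxn i j); apply: subspL => //.
  by apply: homo_chain Da => //; exact: leq_maxl.
by apply: homo_chain Db => //; exact: leq_maxr.
Qed.

Lemma cod_chain n M S (D : nat -> set X) : subsp M -> subsp S -> M `<=` S ->
  (forall i, subsp (D i)) -> (forall i, D i `<=` D i.+1) -> M `<=` D 0 ->
  cod n M S -> (forall x, S x -> exists i, D i x) -> exists d, S `<=` D d.
Proof.
move=> hM hS MS hD Dinc MD cMS SD.
apply: (cod_ind (P := fun h => exists d, h `<=` D d) hM hS MS cMS).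
  by exists 0%N.
move=> h hh _ hS' [d hd] [u Su nhu]; have [e De] := SD u Su.
exists u; split=> //; exists (maxn d e); apply: adj_sub => //.
  by move=> x /hd; apply: homo_chain => //; exact: leq_maxl.
by apply: homo_chain De => //; exact: leq_maxr.
Qed.

Lemma cod_basis n F E : subsp F -> subsp E -> F `<=` E -> cod n F E ->
  exists m (v : 'I_m -> X), [/\ forall i, E (v i),
    forall z, E z -> exists c : 'rV[K]_m, F (z - \sum_(i < m) c ord0 i *: v i)
  & forall c : 'rV[K]_m, F (\sum_(i < m) c ord0 i *: v i) -> c = 0].
Proof.
move=> hF hE FE cFE.
pose P h := exists m (v : 'I_m -> X), [/\ forall i, h (v i),
    forall z, h z -> exists c : 'rV[K]_m, F (z - \sum_(i < m) c ord0 i *: v i)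
  & forall c : 'rV[K]_m, F (\sum_(i < m) c ord0 i *: v i) -> c = 0].
rewrite -/(P E); apply: (cod_ind hF hE FE cFE).
  exists 0%N, (fun _ => 0); split=> [[]//|z Fz|c _]; last by apply/rowP; case.
  by exists 0; rewrite big_ord0 subr0.
move=> h hh Fh hE' [m [v [hv sp ind]]] [u Eu nhu]; exists u; split=> //.
exists m.+1, (fun i => if unlift ord0 i is Some j then v j else u).
have sumE (c : 'rV[K]_m.+1) :
    \sum_(i < m.+1) c ord0 i *: (if unlift ord0 i is Some j then v j else u) =
    c ord0 ord0 *: u + \sum_(i < m) (\row_j c ord0 (lift ord0 j)) ord0 i *: v i.
  rewrite big_ord_recl unlift_none; congr (_ + _).
  by apply: eq_bigr => i _; rewrite liftK mxE.
split=> [i|z [a hz]|c].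
- by case: unliftP => [j _|_]; [exact: sub_adj|exact: adj_gen].
- have [c Fc] := sp _ hz.
  exists (\row_i if unlift ord0 i is Some j then c ord0 j else a).
  rewrite sumE mxE unlift_none opprD addrA.
  rewrite (_ : (\row_j _) = c) //.
  by apply/rowP => j; rewrite !mxE liftK.
- rewrite sumE => Fs.
  have hs : h (\sum_(i < m) (\row_j c ord0 (lift ord0 j)) ord0 i *: v i).
    by apply: subsp_sum => // i _; exact: subspZ.
  have c0 : c ord0 ord0 = 0.
    apply/eqP; apply: contra_notT nhu => c0; apply: (@subspZ_inv _ (c ord0 ord0)) => //.
    apply: (subspDl hh hs); rewrite addrC; exact: Fh.
  rewrite c0 scale0r add0r in Fs; have /rowP r0 := ind _ Fs.
  apply/rowP => i; rewrite mxE; case: (unliftP ord0 i) => [j ->|->] //.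
  by have := r0 j; rewrite !mxE.
Qed.

Lemma cod_span n F E (v : 'I_n -> X) :
  (forall z, E z -> exists c : 'rV[K]_n, F (z - \sum_(i < n) c ord0 i *: v i)) ->
  cod n F E.
Proof.
elim: n F v => [|n IH] F v h.
  by move=> z /h [c]; rewrite big_ord0 subr0.
exists (v ord0); apply: (IH _ (v \o lift ord0)) => z /h [c].
rewrite big_ord_recl opprD addrCA => Fc; exists (\row_j c ord0 (lift ord0 j)).
exists (c ord0 ord0); rewrite addrC.
by under eq_bigr do rewrite mxE.
Qed.

End Subspaces.

Section Linear.
Context {K : fieldType} {X Y : lmodType K}.
Implicit Types (T : X -> Y).

Lemma islin0 T : islin T -> T 0 = 0.
Proof.
move=> hT; have := hT (-1) 0 0.
by rewrite scaler0 addr0 scaleN1r addNr.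
Qed.

Lemma islinD T a b : islin T -> T (a + b) = T a + T b.
Proof. by move=> h; rewrite -[a]scale1r h !scale1r. Qed.

Lemma islinZ T c a : islin T -> T (c *: a) = c *: T a.
Proof. by move=> h; rewrite -[c *: a]addr0 h (islin0 h) addr0. Qed.

Lemma islinN T a : islin T -> T (- a) = - T a.
Proof. by move=> h; rewrite -scaleN1r islinZ // scaleN1r. Qed.

Lemma islinB T a b : islin T -> T (a - b) = T a - T b.
Proof. by move=> h; rewrite islinD // islinN. Qed.

Lemma islin_sum T (I : Type) (r : seq I) (P : pred I) (f : I -> X) : islin T ->
  T (\sum_(i <- r | P i) f i) = \sum_(i <- r | P i) T (f i).
Proof.
move=> h; elim/big_rec2: _ => [|i x y _ <-]; first exact: islin0.
by rewrite islinD.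
Qed.

Lemma subsp_preim T (N : set Y) : islin T -> subsp N -> subsp (T @^-1` N).
Proof.
move=> hT hN; split; first by rewrite /preimage /= islin0 //; exact: subsp0.
by move=> c a b; rewrite /preimage /= hT; case: hN => _; apply.
Qed.

Lemma cod_preim T n (N : set Y) (S : set X) : islin T -> subsp N -> subsp S ->
  cod n N setT -> cod n (S `&` T @^-1` N) S.
Proof.
move=> hT + hS; elim: n N => [|n IH] N hN; first by move=> NT x Sx; split=> //; exact: NT.
rewrite codS => -[v cv]; have := IH _ (subsp_adj v hN) cv.
have [[w [Sw [c Nw]] nNw]|nw] :=
    pselect (exists2 w, (S `&` T @^-1` adj N v) w & ~ N (T w)); last first.
  (* Nothing in [S] is mapped into [adj N v] outside [N], so the count is kept by adjoining [0]. *)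
  move=> h; exists 0; apply: (cod_sub _ (@subset_refl _ S) h) => x [Sx NTx].
  apply: sub_adj; split=> //.
  by apply: contrapT => nx; apply: nw; exists x.
move=> h; exists w; apply: (cod_sub _ (@subset_refl _ S) h) => x [Sx [a Nx]].
have c0 : c != 0 by apply/eqP => c0; apply: nNw; rewrite c0 scale0r subr0 in Nw.
exists (a / c); split.
  by apply: subspB => //; exact: subspZ.
rewrite /preimage /= islinB // islinZ //.
have -> : T x - (a / c) *: T w = (T x - a *: v) - (a / c) *: (T w - c *: v).
  by rewrite scalerBr scalerA divfK // opprB addrA subrK.
by apply: subspB => //; exact: subspZ.
Qed.

End Linear.

(** * Nilpotent actions on a pair of subspaces *)

Section Nilpotence.
Context {K : fieldType} {X : lmodType K}.
Implicit Types (V W Y : set X) (S : set (X -> X)) (T c y : X -> X).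

Definition maps T V W := forall f, V f -> W (T f).

(** Iterated from [W] with [S] and [V] fixed, this gives the annihilator series of [S] on [V] modulo
    [W]. *)
Definition ann S V W : set X := [set f | V f /\ forall T, S T -> W (T f)].

(* All sufficiently long products of elements of [S] map [V] into [W]. *)
Definition nilp S V W := exists k, V `<=` iter k (ann S V) W.

Lemma ann_mono S V V' W W' : V `<=` V' -> W `<=` W' ->
  ann S V W `<=` ann S V' W'.
Proof. by move=> h0 h1 f [/h0 Yf h]; split=> // T /h /h1. Qed.

Lemma iter_ann_mono k S V V' W W' : V `<=` V' -> W `<=` W' ->
  iter k (ann S V) W `<=` iter k (ann S V') W'.
Proof. by move=> h0 h1; elim: k => //= k IH; exact: ann_mono. Qed.

Lemma nilp_trans S V Y W : Y `<=` V -> nilp S V Y -> nilp S Y W -> nilp S V W.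
Proof.
move=> YX [k hk] [m hm]; exists (k + m)%N; rewrite iterD => f /hk.
apply: iter_ann_mono => // g /hm.
exact: iter_ann_mono.
Qed.

(** Otherwise [ann S V W] is contained in [W], hence so are all its iterates, and [V] with them. *)
Lemma nilp_fix S V W : nilp S V W -> ~ (V `<=` W) ->
  exists f, [/\ V f, ~ W f & forall T, S T -> W (T f)].
Proof.
move=> [k hk] nVW; apply: contrapT => H; apply: nVW => f /hk.
have aW : ann S V W `<=` W.
  by move=> g [Vg Sg]; apply: contrapT => nWg; apply: H; exists g.
elim: k {hk} f => [//|k IH] f /= [Vf Sf]; apply: aW; split=> // T /Sf; exact: IH.
Qed.

Lemma subsp_ann S V W : (forall T, S T -> islin T) -> subsp V -> subsp W ->
  subsp (ann S V W).
Proof.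
move=> hS hV hW; split.
  by split; [exact: (subsp0 hV)|move=> T ST;
    rewrite (islin0 (hS _ ST)); exact: (subsp0 hW)].
move=> a f g [Vf Sf] [Vg Sg]; split; first exact: subspL.
by move=> T ST; rewrite hS //; apply: subspL => //; [exact: Sf|exact: Sg].
Qed.

Lemma subsp_iter_ann k S V W : (forall T, S T -> islin T) -> subsp V ->
  subsp W -> subsp (iter k (ann S V) W).
Proof. by move=> hS hV hW; elim: k => //= k IH; exact: subsp_ann. Qed.

Lemma iter_ann_sub k S V W : W `<=` V -> iter k (ann S V) W `<=` V.
Proof. by case: k => // k WV f []. Qed.

Lemma sub_iter_annS k S V W : W `<=` V -> (forall T, S T -> maps T W W) ->
  iter k (ann S V) W `<=` iter k.+1 (ann S V) W.
Proof.
move=> WV SW; elim: k => [|k IH] f /=.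
  by move=> Wf; split=> [|T ST]; [exact: WV|exact: SW].
by move=> [Vf Sf]; split=> // T /Sf /IH.
Qed.

Lemma sub_iter_ann k S V W : W `<=` V -> (forall T, S T -> maps T W W) ->
  W `<=` iter k (ann S V) W.
Proof.
by move=> WV SW; elim: k => // k IH f /IH; exact: sub_iter_annS.
Qed.

Lemma maps_iter T V p : maps T V V -> maps (iter p T) V V.
Proof. by move=> h; elim: p => [|p IH] f //= /IH; exact: h. Qed.

Lemma islin_iter T p : islin T -> islin (iter p T).
Proof. by move=> h; elim: p => [|p IH] c a b //=; rewrite IH h. Qed.

Lemma nilp_layers S V W k : W `<=` V -> (forall T, S T -> maps T W W) ->
  forall S', (forall j, nilp S' (iter j.+1 (ann S V) W) (iter j (ann S V) W)) ->
  V `<=` iter k (ann S V) W -> nilp S' V W.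
Proof.
move=> WV SW S' H Vk.
have E : V = iter k (ann S V) W by apply/seteqP; split=> //; exact: iter_ann_sub.
rewrite {1}E; elim: k {Vk E} => [|k IH]; first by exists 0%N.
apply: nilp_trans (H k) IH; exact: sub_iter_annS.
Qed.

(* As [c] normalises [S], it preserves the successive annihilators of [S], and
   on each of their quotients [S'] acts through multiples of [c]. *)
Lemma nilp_step S S' c V W : subsp V -> subsp W -> W `<=` V ->
  (forall T, S T -> [/\ islin T, maps T V V & maps T W W]) ->
  islin c -> maps c V V -> maps c W W ->
  (exists m, maps (iter m c) V W) -> nilp S V W ->
  (forall T, S T -> exists2 T', S T' &
     forall f, V f -> W (T (c f) - c (T f) - T' f)) ->
  (forall T, S' T -> exists2 T', S T' & exists a : K,
     forall f, V f -> W (T f - (T' f + a *: c f))) ->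
  nilp S' V W.
Proof.
move=> hV hW WV hS hc cV cW [m cm] [k hk] norm S'S.
have Sl T : S T -> islin T by move/hS => [].
have SW T : S T -> maps T W W by move/hS => [].
pose Y j := iter j (ann S V) W.
have hY j : subsp (Y j) by exact: subsp_iter_ann.
have YV j : Y j `<=` V by exact: iter_ann_sub.
have WY j : W `<=` Y j by exact: sub_iter_ann.
have cY j : maps c (Y j) (Y j).
  elim: j => [//|j IH] f [Vf Sf]; split; first exact: cV.
  move=> T ST; have [T' ST' h] := norm T ST.
  have := WY j _ (h f Vf).
  have hs : Y j (c (T f) + T' f) by apply: subspD => //; [exact/IH/Sf|exact: Sf].
  move=> h'; rewrite -[X in Y j X](subrK (c (T f) + T' f)).
  by rewrite opprD (addrA (T (c f))); exact: (subspD (hY j) h' hs).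
apply: (nilp_layers (k := k) WV SW) => // j.
exists m => f Yf.
have : Y j (iter m c f) by apply: WY; apply: cm; exact: YV Yf.
(* Each application of [T] lowers by one the exponent [p] for which [c ^ p f] lies in [Y j]: [T' f]
   is in [Y j] because [f] is in [Y j.+1], and [a *: c f] needs one power of [c] fewer. *)
elim: m {cm} f Yf => [//|p IH] f Yf cf /=; split=> // T S'T.
have [T' ST' [a h]] := S'S T S'T.
have [Vf Sf] := Yf.
have Wh := h f Vf.
have YT' : Y j (T' f) by exact: Sf.
pose w := T f - (T' f + a *: c f).
have TfE : T f = w + (T' f + a *: c f) by rewrite subrK.
apply: IH.
  rewrite TfE; apply: subspD (hY j.+1) (WY j.+1 _ Wh) _.
  apply: subspD => //; first exact: (sub_iter_annS WV SW).
  apply: subspZ => //; exact: (cY j.+1).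
have hcp : islin (iter p c) by exact: islin_iter.
rewrite TfE (islinD _ _ hcp) (islinD _ _ hcp) (islinZ _ _ hcp) -iterSr.
apply: subspD => //; first by apply: WY; exact: (maps_iter p cW).
apply: subspD => //; last exact: subspZ.
exact: (maps_iter p (cY j)).
Qed.

End Nilpotence.

(** * Derivatives and sums of commuting nilpotent operators *)

Section Derivation.
Context {K : numFieldType} {X : lmodType K} (V W : set X).
Hypotheses (hV : subsp V) (hW : subsp W) (WV : W `<=` V).

Definition stab T := [/\ islin T, maps T V V & maps T W W].

Local Notation eqm f g := (W (f - g)).

Lemma eqm_trans g f h : eqm f g -> eqm g h -> eqm f h.
Proof. by move=> a b; rewrite -(subrKA g); exact: subspD. Qed.

Lemma eqm_sym f g : eqm f g -> eqm g f.
Proof. by move=> a; rewrite -opprB; exact: subspN. Qed.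

Lemma eqm_refl f : eqm f f.
Proof. by rewrite subrr; exact: subsp0. Qed.

Lemma eqmD f g f' g' : eqm f g -> eqm f' g' -> eqm (f + f') (g + g').
Proof. by move=> a b; rewrite opprD addrACA; exact: subspD. Qed.

Lemma eqm_op T f g : stab T -> eqm f g -> eqm (T f) (T g).
Proof. by move=> [Tl _ TW] h; rewrite -islinB //; exact: TW. Qed.

Lemma eqm_in f g : eqm f g -> W g -> W f.
Proof. by move=> h Wg; rewrite -(subrK g f); exact: subspD. Qed.

Lemma stab_iter T p : stab T -> stab (iter p T).
Proof.
by move=> [? ? ?]; split; [exact: islin_iter|exact: maps_iter|exact: maps_iter].
Qed.

Lemma stabZD (a : K) T T' : stab T -> stab T' -> stab (fun f => a *: T f + T' f).
Proof.
move=> [Tl TV TW] [Tl' TV' TW']; split.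
- by move=> c f g; rewrite Tl Tl' !scalerDr !scalerA mulrC addrACA.
- by move=> f Vf; apply: subspL => //; [exact: TV|exact: TV'].
- by move=> f Wf; apply: subspL => //; [exact: TW|exact: TW'].
Qed.

Lemma comm_iterm p T T' : stab T -> stab T' ->
  (forall f, V f -> eqm (T (T' f)) (T' (T f))) ->
  forall f, V f -> eqm (T (iter p T' f)) (iter p T' (T f)).
Proof.
move=> hT hT' h; elim: p => [|p IH] f Vf /=; first exact: eqm_refl.
apply: (@eqm_trans (T' (T (iter p T' f)))).
  by apply: h; have [_ + _] := stab_iter p hT'; apply.
by apply: eqm_op => //; exact: IH.
Qed.

Lemma der_iter p y c d : stab y -> stab c -> stab d ->
  (forall f, V f -> eqm (y (c f)) (c (y f) + d f)) ->
  (forall f, V f -> eqm (d (c f)) (c (d f))) ->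
  forall f, V f ->
    eqm (y (iter p c f)) (iter p c (y f) + p%:R *: iter p.-1 c (d f)).
Proof.
move=> hy hc hd yc dc; elim: p => [|p IH] f Vf /=.
  by rewrite scale0r addr0; exact: eqm_refl.
have Vp : V (iter p c f) by have [_ + _] := stab_iter p hc; apply.
apply: (eqm_trans (yc _ Vp)).
have cl : islin c by case: hc.
have := eqmD (eqm_op hc (IH f Vf)) (comm_iterm p hd hc dc Vf).
rewrite (islinD _ _ cl) (islinZ _ _ cl) -(addrA (c (iter p c (y f)))) => h.
apply: (eqm_trans h).
rewrite -natr1 scalerDl scale1r.
case: p {IH h Vp} => [|p]; last exact: eqm_refl.
by rewrite !scale0r !add0r; exact: eqm_refl.
Qed.

(* If [c] is nilpotent on [V / W] and commutes with its derivative
   [d = [y, c]], then [d] is nilpotent: [c ^ n = 0] gives successively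
   [c ^ (n - k) * d ^ (2 * k) = 0]. *)
Lemma der_nilp y c d e n : stab y -> stab c -> stab d -> stab e ->
  (forall f, V f -> eqm (y (c f)) (c (y f) + d f)) ->
  (forall f, V f -> eqm (y (d f)) (d (y f) + e f)) ->
  (forall f, V f -> eqm (d (c f)) (c (d f))) ->
  (forall f, V f -> eqm (e (d f)) (d (e f))) ->
  maps (iter n c) V W -> maps (iter n.*2 d) V W.
Proof.
move=> hy hc hd he yc yd dc ed cn.
have itV T p f : stab T -> V f -> V (iter p T f).
  by move=> /(stab_iter p) [_ + _]; apply.
suff H k : (k <= n)%N -> forall f, V f -> W (iter (n - k) c (iter k.*2 d f)).
  by move=> f Vf; have := H n (leqnn n) f Vf; rewrite subnn.
elim: k => [|k IH] kn f Vf; first by rewrite subn0; exact: cn.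
have {}IH := IH (ltnW kn).
rewrite doubleS; set q := k.*2 in IH *; set p := (n - k.+1)%N.
have pE : (n - k)%N = p.+1 by rewrite /p subnSK.
rewrite pE in IH.
have [dl dV dW] := hd; have [yl yV yW] := hy; have [_ eV _] := he.
(* Apply [y] to [c ^ p.+1 d ^ q f], which is zero modulo [W]. The term in [y f] vanishes by [IH].
   One more factor [d] turns [d ^ q.-1 (e f)] into [d ^ q (e f)], which vanishes as well, and [p.+1]
   times [c ^ p d ^ q.+2 f] remains; this is why each lost [c] costs two factors [d]. *)
have Wq : W (iter p.+1 c (iter q d (y f))) by exact/IH/yV.
have h1 : eqm (y (iter p.+1 c (iter q d f)))
    (iter p.+1 c (y (iter q d f)) + p.+1%:R *: iter p c (d (iter q d f))).
  by apply: der_iter => //; exact: itV.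
have h2 : eqm (y (iter q d f)) (iter q d (y f) + q%:R *: iter q.-1 d (e f)).
  exact: der_iter.
have hcp := stab_iter p.+1 hc; have [cpl _ _] := hcp.
have h3 := eqm_op hcp h2.
rewrite (islinD _ _ cpl) (islinZ _ _ cpl) in h3.
have W1 : W (iter p.+1 c (q%:R *: iter q.-1 d (e f)) +
             p.+1%:R *: iter p c (d (iter q d f))).
  have a1 : W (y (iter p.+1 c (iter q d f))) by exact/yW/IH.
  have a2 := eqm_in (eqm_sym h1) a1.
  have a3 := eqm_in (eqm_sym (eqmD h3 (eqm_refl (p.+1%:R *: iter p c (d (iter q d f)))))) a2.
  by rewrite -addrA in a3; rewrite (islinZ _ _ cpl); exact: (subspDl hW Wq a3).
have W2 := dW _ W1; rewrite (islinD _ _ dl) (islinZ _ _ dl) in W2.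
have Ve : V (e f) by exact: eV.
have W3 : W (d (iter p.+1 c (q%:R *: iter q.-1 d (e f)))).
  rewrite (islinZ _ _ cpl) (islinZ _ _ dl).
  (* At [q = 0] the truncated [q.-1] is harmless, its coefficient [q%:R] being zero. *)
  case: q IH {Wq h1 h2 h3 W1 W2} => [|q] IH.
    by rewrite scale0r; exact: subsp0.
  apply: subspZ => //; apply: (eqm_in (comm_iterm _ hd hc dc _)); first exact: itV.
  exact: IH.
have W4 := subspDl hW W3 W2.
have {}W4 := subspZ_inv (lt0r_neq0 (ltr0Sn _ _)) hW W4.
have := comm_iterm p hd hc dc (itV d q.+1 f hd Vf).
move=> /eqm_sym /eqm_in; apply.
exact: W4.
Qed.

(** Let [Y j] be the kernel of [c ^ j] modulo [W]. On [Y j.+1] modulo [Y j] the operators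
    [a *: c + d] and [d] agree, so [n] applications descend one level; hence the exponent
    [m * n]. *)
Lemma nilpD (a : K) c d m n : stab c -> stab d ->
  (forall f, V f -> eqm (d (c f)) (c (d f))) ->
  maps (iter m c) V W -> maps (iter n d) V W ->
  maps (iter (m * n) (fun f => a *: c f + d f)) V W.
Proof.
move=> hc hd dc cm dn; set s := fun f => _.
pose Y j : set X := [set f | V f /\ W (iter j c f)].
have hs : stab s by exact: stabZD.
have [sl sV sW] := hs; have [cl cV cW] := hc; have [dl dV dW] := hd.
have icl j : islin (iter j c) by exact: islin_iter.
have hY j : subsp (Y j).
  split; first by split; [exact: subsp0|rewrite islin0 //; exact: subsp0].
  move=> b f g [Vf Wf] [Vg Wg]; split; first exact: subspL.
  by rewrite icl; apply: subspL.
have WY j : W `<=` Y j.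
  by move=> f Wf; split; [exact: WV|exact: maps_iter].
have YS j : Y j `<=` Y j.+1 by move=> f [Vf Wf]; split=> //=; exact: cW.
have dY j : maps d (Y j) (Y j).
  move=> f [Vf Wf]; split; first exact: dV.
  by apply: (eqm_in (eqm_sym (comm_iterm j hd hc dc Vf))); exact: dW.
have cY j : maps c (Y j.+1) (Y j).
  by move=> f [Vf Wf]; split; [exact: cV|rewrite -iterSr].
have sY j : maps s (Y j.+1) (Y j.+1).
  by move=> f Yf; apply: subspL => //; [exact/YS/cY|exact: dY].
suff H j f : Y j f -> W (iter (j * n) s f).
  by move=> f Vf; apply: H; split=> //; exact: cm.
elim: j f => [|j IH] f; first by rewrite mul0n => -[].
move=> Yf; rewrite mulSn addnC iterD; apply: IH.
have H p : Y j (iter p s f - iter p d f) /\ Y j.+1 (iter p s f).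
  elim: p => [|p [IH1 IH2]] /=; first by rewrite subrr; split=> //; exact: subsp0.
  split; last exact: sY.
  rewrite {1}/s -addrA -(islinB _ _ dl).
  exact: (subspL a (hY j) (cY j _ IH2) (dY j _ IH1)).
have [H1 _] := H n.
rewrite -(subrK (iter n d f) (iter n s f)); apply: subspD => //; apply: WY.
by apply: dn; case: Yf.
Qed.

End Derivation.

Definition opcomm (K : fieldType) (X : lmodType K) (T S : X -> X) : X -> X :=
  fun f => T (S f) - S (T f).

Lemma opcommN (K : fieldType) (X : lmodType K) (T S : X -> X) :
  opcomm T S = - opcomm S T.
Proof. by apply/funext => f; rewrite /opcomm [RHS]opprB. Qed.

Lemma opcomm_jacobi (K : fieldType) (X : lmodType K) (y v w : X -> X) :
  islin y -> islin v -> islin w ->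
  opcomm (opcomm y v) w = opcomm y (opcomm v w) - opcomm v (opcomm y w).
Proof.
move=> yl vl wl; apply/funext => f.
change (opcomm (opcomm y v) w f =
  opcomm y (opcomm v w) f - opcomm v (opcomm y w) f).
rewrite /opcomm !(islinB _ _ wl, islinB _ _ yl, islinB _ _ vl) !opprB.
rewrite [RHS]addrACA !subrKA [LHS]addrACA (addrC (- _)) -[LHS]addrACA.
by [].
Qed.

(** * Nilpotence of the negative part of a graded Lie algebra of operators *)

Section GradedNilpotence.
Context {K : numFieldType} {X : lmodType K}.
(** [n i] holds the operators of degree [- i]. Generation and finiteness are required only up to
    operators that are trivial on [V0 / W0]; this pair stays fixed, while the pairs [V], [W] below
    run through the layers of annihilator series. *)
Variables (n : nat -> set (X -> X)) (a : X -> X) (V0 W0 : set X).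
Hypotheses (nlin : forall i T, n i T -> islin T) (nsub : forall i, subsp (n i))
  (ncomm : forall i j T S, n i T -> n j S -> n (i + j)%N (opcomm T S))
  (na : n 1 a)
  (gen1 : forall Z, subsp Z -> (forall T, n 1 T -> maps T V0 W0 -> Z T) ->
     Z a -> (forall y T, n 0 y -> n 1 T -> Z T -> Z (opcomm y T)) -> n 1 `<=` Z)
  (genS : forall i Z, subsp Z -> (forall T, n i.+2 T -> maps T V0 W0 -> Z T) ->
     (forall u w, n 1 u -> n i.+1 w -> Z (opcomm u w)) -> n i.+2 `<=` Z)
  (hW0 : subsp W0) (nst0 : forall i T, n i T -> stab V0 W0 T)
  (nfin : forall i, exists m,
     cod m (n i.+1 `&` [set T | maps T V0 W0]) (n i.+1)).

Section Layer.
Variables (V W : set X) (d : nat).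
Hypotheses (hV : subsp V) (hW : subsp W) (WV : W `<=` V)
  (nst : forall i T, n i T -> stab V W T)
  (triv : forall T, maps T V0 W0 -> maps T V W)
  (deep : forall i T, (d.+1 < i)%N -> n i T -> maps T V W)
  (anil : exists N, maps (iter N a) V W).

Let Z := [set c | n d.+1 c /\ exists m, maps (iter m c) V W].

Let Zsub : subsp Z.
Proof.
split.
  split; first exact: (subsp0 (nsub _)).
  by exists 1%N => f Vf; exact: (subsp0 hW).
move=> k c c' [nc [m cm]] [nc' [m' cm']]; split; first exact: (subspL k (nsub _)).
exists (m * m')%N; apply: (nilpD hV hW WV k (nst nc) (nst nc') _ cm cm').
move=> f Vf; apply: (deep _ (ncomm nc' nc)) => //.
by rewrite addSnnS ltn_addl.
Qed.

Let Zder y c : n 0 y -> Z c -> Z (opcomm y c).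
Proof.
move=> ny [nc [m cm]]; have nd := ncomm ny nc; have ne := ncomm ny nd.
split=> //; exists m.*2.
apply: (der_nilp hW (nst ny) (nst nc) (nst nd) (nst ne) _ _ _ _ cm) => //.
- by move=> f _; rewrite /opcomm subrKC; exact: (eqm_refl hW).
- by move=> f _; rewrite /opcomm subrKC; exact: (eqm_refl hW).
- move=> f Vf; apply: (deep _ (ncomm nd nc)) => //.
  by rewrite add0n addSnnS ltn_addl.
- move=> f Vf; apply: (deep _ (ncomm ne nd)) => //.
  by rewrite !add0n addSnnS ltn_addl.
Qed.

(** For [d = 0] the operator [a] itself is in [Z]. Otherwise it suffices to treat brackets of [n 1]
    with the next lower degree. The [v] in [n 1] whose brackets all lie in [Z] form a subspace
    stable under [n 0] by the Jacobi identity; it contains [a], because [[w, a]] is the derivative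
    by [w] of the nilpotent operator [a] and everything deeper acts trivially. *)
Let Zall : n d.+1 `<=` Z.
Proof.
have Ztriv T : n d.+1 T -> maps T V0 W0 -> Z T.
  by move=> nT /triv h; split=> //; exists 1%N.
case: d deep @Z Zsub Zder Ztriv => [|d'] deep' Z' Zsub' Zder' Ztriv'.
  by apply: gen1 => // y T ny _; exact: Zder'.
apply: genS => // u w.
pose U := [set v | n 1 v /\ forall w, n d'.+1 w -> Z' (opcomm v w)].
have : n 1 `<=` U.
  have lU v w' : n 1 v -> n d'.+1 w' -> islin v /\ islin w'.
    by move=> ? ?; split; apply: nlin; eauto.
  apply: gen1.
  - split.
      split=> [|w' nw']; first exact: (subsp0 (nsub _)).
      rewrite (_ : opcomm _ _ = 0); first exact: (subsp0 Zsub').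
      apply/funext => f; rewrite /opcomm /= (islin0 (nlin nw')).
      by rewrite [LHS]subr0.
    move=> k v v' [nv hv] [nv' hv']; split; first exact: (subspL k (nsub _)).
    move=> w' nw'.
    rewrite (_ : opcomm _ _ = k *: opcomm v w' + opcomm v' w').
      by apply: (subspL k Zsub'); [exact: hv|exact: hv'].
    apply/funext => f.
    transitivity (k *: v (w' f) + v' (w' f) - w' (k *: v f + v' f)) => //.
    rewrite (nlin nw') opprD addrACA -scalerBr //.
  - move=> T nT tT; split=> // w' nw'; apply: Ztriv'; first exact: ncomm nT nw'.
    move=> f Vf; have [_ wV wW] := nst0 nw'.
    by apply: (subspB hW0); [exact/tT/wV|exact/wW/tT].
  - split=> // w' nw'.
    rewrite opcommN; apply: (subspN Zsub').
    have nd := ncomm nw' na; have ne := ncomm nw' nd.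
    rewrite addn1 in nd ne.
    split=> //; have [N aN] := anil; exists N.*2.
    apply: (der_nilp hW (nst nw') (nst na) (nst nd) (nst ne) _ _ _ _ aN) => //.
    + by move=> f _; rewrite /opcomm subrKC; exact: (eqm_refl hW).
    + by move=> f _; rewrite /opcomm subrKC; exact: (eqm_refl hW).
    + move=> f Vf; apply: (deep' _ _ _ (ncomm nd na)) => //.
      by rewrite addn1.
    + move=> f Vf; apply: (deep' _ _ _ (ncomm ne nd)) => //.
      by rewrite -addnA addSn ltnS (leq_trans (leq_addl _ _) (leq_addl _ _)).
  - move=> y T ny nT [_ hT]; split; first exact: ncomm ny nT.
    move=> w' nw'; rewrite opcomm_jacobi; [|exact: nlin ny|exact: nlin nT|exact: nlin nw'].
    apply: (subspB Zsub'); first by apply: Zder' => //; exact: hT.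
    by apply: hT; exact: ncomm ny nw'.
by move=> nU nu nw; have [_] := nU u nu; apply.
Qed.

(** The operators of the lowest degree commute modulo [W] and are nilpotent one by one. Modulo
    trivial operators they span a finite-dimensional space, so adjoining them singly by [nilp_step],
    with zero as the bracket correction, gives joint nilpotence. *)
Lemma layer_nilp : nilp (n d.+1) V W.
Proof.
have [m cm] := nfin d.
apply: (cod_ind (P := fun h => nilp h V W) _ (nsub d.+1) _ cm).
- apply: subspI => //; split=> [f Vf|k T S hT hS f Vf]; first exact: (subsp0 hW0).
  by apply: (subspL k hW0); [exact: hT|exact: hS].
- by move=> T [].
- by exists 1%N => f Vf; split=> // T [_ /triv]; apply.
move=> h hh _ hn nh [u nu nhu]; exists u; split=> //.
have [_ cm'] := Zall nu; have [ul uV uW] := nst nu.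
apply: (nilp_step (S := h) hV hW WV _ ul uV uW cm' nh) => [T /hn /nst //|T hT|T [k hT]].
- exists 0; first exact: (subsp0 hh).
  move=> f Vf; rewrite subr0.
  apply: (deep _ (ncomm (hn _ hT) nu)) => //; by rewrite addSnnS ltn_addl.
- exists (T - k *: u) => //; exists k => f Vf.
  rewrite (_ : _ - _ = 0); first exact: (subsp0 hW).
  by apply/eqP; rewrite subr_eq0; apply/eqP; exact: (esym (subrK (k *: u f) (T f))).
Qed.

End Layer.

(** On each quotient of the annihilator series of the lowest degree [d.+1], that degree acts
    trivially by construction, so the depth falls to [d]. *)
Lemma graded_nilp d (V W : set X) : subsp V -> subsp W -> W `<=` V ->
  (forall i T, n i T -> stab V W T) ->
  (forall T, maps T V0 W0 -> maps T V W) ->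
  (forall i T, (d < i)%N -> n i T -> maps T V W) ->
  (exists N, maps (iter N a) V W) -> nilp (n 1) V W.
Proof.
elim: d V W => [|d IH] V W hV hW WV nst triv deep anil.
  by exists 1%N => f Vf; split=> // T /(deep 1%N T isT); apply.
have nS T : n d.+1 T -> islin T by exact: nlin.
have nW T : n d.+1 T -> maps T W W by move/nst => [].
have [k hk] := layer_nilp hV hW WV nst triv deep anil.
apply: (nilp_layers WV nW _ hk) => j.
have YV i : iter i (ann (n d.+1) V) W `<=` V by exact: iter_ann_sub.
have WY i : W `<=` iter i (ann (n d.+1) V) W by exact: sub_iter_ann.
have hY i : subsp (iter i (ann (n d.+1) V) W) by exact: subsp_iter_ann.
have YS i T : n i T -> forall j,
    maps T (iter j (ann (n d.+1) V) W) (iter j (ann (n d.+1) V) W).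
  move=> nT; have [Tl TV TW] := nst i T nT; elim=> [//|p IHp] f [Vf Sf].
  split=> [|c nc]; first exact: TV.
  rewrite -(subrK (T (c f)) (c (T f))); apply: (subspD (hY p)); last exact/IHp/Sf.
  have nc' : n (d.+1 + i)%N (opcomm c T) by exact: ncomm.
  case: i nT nc' => [|i] nT nc'; first by rewrite addn0 in nc'; exact: (Sf _ nc').
  by apply: WY; apply: (deep _ _ _ nc') => //; rewrite addnS ltnS leq_addr.
apply: IH => //.
- exact: sub_iter_annS.
- by move=> i T nT; split; [exact: nlin nT|exact: YS nT _|exact: YS nT _].
- by move=> T /triv h f /YV /h /WY.
- move=> i T; rewrite leq_eqVlt => /predU1P[<-|di] nT f /=; first by move=> [_]; apply.
  by move=> [Vf _]; apply: WY; exact: (deep _ _ di nT).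
- by have [N aN] := anil; exists N => f /YV /aN /WY.
Qed.

End GradedNilpotence.

(** * Generalised eigenspaces modulo a subspace *)

Section Shift.
Context {K : fieldType} {X : lmodType K} (T : X -> X).

Definition shift_op (mu : K) : X -> X := fun z => T z - mu *: z.

Lemma islin_shift mu : islin T -> islin (shift_op mu).
Proof.
move=> Tl c a b; rewrite /shift_op Tl scalerDr opprD addrACA; congr (_ + _).
by rewrite scalerBr !scalerA mulrC.
Qed.

Lemma maps_shift mu Y : subsp Y -> maps T Y Y -> maps (shift_op mu) Y Y.
Proof. by move=> hY TY z Yz; apply: subspB => //; [exact: TY|exact: subspZ]. Qed.

End Shift.

Lemma eigenvector_mod (K : closedFieldType) (X : lmodType K) (T : X -> X)
  (F E : set X) n : islin T -> subsp F -> subsp E -> F `<=` E -> maps T E E ->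
  cod n F E -> (exists2 u, E u & ~ F u) ->
  exists mu u, [/\ E u, ~ F u & F (shift_op T mu u)].
Proof.
move=> Tl hF hE FE TE cFE.
move=> [u Eu nFu]; have [m [v [Ev sp ind]]] := cod_basis hF hE FE cFE.
have m0 : (0 < m)%N.
  rewrite lt0n; apply: contra_notN nFu => /eqP m0; have [c] := sp u Eu.
  by rewrite big1 ?subr0 // => i; have := ltn_ord i; rewrite [X in (_ < X)%N]m0 ltn0.
have /choice[c hc] : forall i, exists c : 'rV[K]_m,
    F (T (v i) - \sum_(j < m) c ord0 j *: v j) by move=> i; exact/sp/TE.
pose A := \matrix_(i < m, j < m) c i ord0 j.
have : size (char_poly A) != 1%N by rewrite size_char_poly; case: (m) m0.
move=> /closed_rootP[mu]; rewrite -eigenvalue_root_char => /eigenvalueP[w wA w0].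
exists mu, (\sum_(i < m) w ord0 i *: v i); split.
- by apply: subsp_sum => // i _; exact: subspZ.
- by move=> /ind w0'; rewrite w0' eqxx in w0.
- have -> : shift_op T mu (\sum_(i < m) w ord0 i *: v i) =
      \sum_(i < m) w ord0 i *: (T (v i) - \sum_(j < m) c i ord0 j *: v j).
    rewrite /shift_op (islin_sum _ _ _ Tl) scaler_sumr.
    under [in LHS]eq_bigr do rewrite (islinZ _ _ Tl).
    under [in RHS]eq_bigr do rewrite scalerBr.
    rewrite [RHS]big_split /= sumrN; congr (_ - _).
    under [RHS]eq_bigr do rewrite scaler_sumr.
    rewrite exchange_big /=; apply: eq_bigr => j _.
    rewrite scalerA; have /rowP/(_ j) := wA.
    rewrite !mxE => <-; rewrite scaler_suml; apply: eq_bigr => i _.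
    by rewrite scalerA mxE.
  by apply: subsp_sum => // i _; exact: subspZ.
Qed.

Section Eigenspaces.
Context {K : closedFieldType} {X : lmodType K}.
Variables (T : X -> X) (F E : set X) (n : nat).
Hypotheses (Tl : islin T) (hF : subsp F) (hE : subsp E) (FE : F `<=` E)
  (TF : maps T F F) (TE : maps T E E) (cFE : cod n F E).

Local Notation shift_op := (shift_op T).

Let islin_shift mu : islin (shift_op mu) := islin_shift mu Tl.

Definition geneig mu : set X :=
  [set w | E w /\ exists m, F (iter m (shift_op mu) w)].

Lemma subsp_geneig mu : subsp (geneig mu).
Proof.
have sF := maps_shift mu hF TF.
split; first by split; [exact: subsp0|exists 0%N; exact: subsp0].
move=> c a b [Ea [i Fa]] [Eb [j Fb]]; split; first exact: subspL.
exists (maxn i j); have il := islin_iter (maxn i j) (islin_shift mu).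
rewrite il; apply: (subspL c hF).
  by rewrite -(subnK (leq_maxl i j)) iterD; exact: maps_iter Fa.
by rewrite -(subnK (leq_maxr i j)) iterD; exact: maps_iter Fb.
Qed.

Lemma geneig_shift mu w : E w -> geneig mu (shift_op mu w) -> geneig mu w.
Proof. by move=> Ew [_ [m Fw]]; split=> //; exists m.+1; rewrite iterSr. Qed.

(* [T - mu] is invertible on the generalised eigenspaces of the other
   eigenvalues. *)
Lemma geneig_solve mu nu x : nu != mu -> geneig nu x ->
  exists2 w, geneig nu w & geneig mu (shift_op mu w - x).
Proof.
move=> ne [Ex [m]]; elim: m x Ex => [|m IH] x Ex Fx.
  exists 0; first exact: (subsp0 (subsp_geneig nu)).
  rewrite (islin0 (islin_shift mu)) sub0r; apply: (subspN (subsp_geneig mu)).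
  by split=> //; exists 0%N.
have d0 : nu - mu != 0 by rewrite subr_eq0.
(* As [T - mu = (T - nu) + (nu - mu)], the vector [k *: x] solves the equation up to
   [k *: (T - nu) x], which [T - nu] kills modulo [F] with one power fewer. *)
pose k := (nu - mu)^-1.
have gx : geneig nu x by split=> //; exists m.+1.
have sl := islin_shift.
have [||w1 gw1 h1] := IH (k *: shift_op nu x).
- by apply: subspZ => //; exact: maps_shift.
- rewrite (islinZ _ _ (islin_iter m (sl nu))) -iterSr; exact: subspZ.
exists (k *: x - w1).
  apply: (subspB (subsp_geneig nu) _ gw1).
  exact: (subspZ _ (subsp_geneig nu) gx).
rewrite (_ : _ - x = - (shift_op mu w1 - k *: shift_op nu x)).
  exact: (subspN (subsp_geneig mu)).
rewrite (islinB _ _ (sl mu)) (islinZ _ _ (sl mu)) [RHS]opprB addrAC; congr (_ - _).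
have -> : shift_op mu x = shift_op nu x + (nu - mu) *: x.
  by rewrite /shift_op scalerBl addrA subrK.
by rewrite scalerDr scalerA mulVf // scale1r addrK.
Qed.

(** [E] is the sum of the generalised eigenspaces, stated as a universal property so that no list of
    eigenvalues has to be carried along. [E] is filled up by eigenvectors modulo what is already
    reached. *)
Lemma geneig_decomp (Z : set X) : subsp Z -> (forall mu, geneig mu `<=` Z) ->
  E `<=` Z.
Proof.
move=> hZ GZ.
pose G := [set x | forall Y : set X, subsp Y -> (forall mu, geneig mu `<=` Y) -> Y x].
suff EG : E `<=` G by move=> x /EG; apply.
have hG : subsp G.
  split=> [Y hY _|c a b Ga Gb Y hY h]; first exact: subsp0.
  by apply: subspL => //; [exact: Ga|exact: Gb].
have gG mu : geneig mu `<=` G by move=> x gx Y _; apply; exact: gx.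
(* The equation [T - mu] can be solved inside [G] up to an element of [geneig mu]; the solution then
   differs from [u] by an element of [geneig mu]. *)
have solve mu u : E u -> G (shift_op mu u) -> G u.
  move=> Eu /(_ [set x | exists2 w, E w /\ G w & geneig mu (shift_op mu w - x)]).
  have gm := subsp_geneig mu.
  case.
  - split.
      exists 0; first by split; [exact: (subsp0 hE)|exact: (subsp0 hG)].
      by rewrite (islin0 (islin_shift mu)) subr0; exact: (subsp0 gm).
    move=> c a b [w [Ew Gw] h] [w' [Ew' Gw'] h']; exists (c *: w + w').
      by split; [exact: (subspL c hE)|exact: (subspL c hG)].
    by rewrite islin_shift opprD addrACA -scalerBr; exact: (subspL c gm).
  - move=> nu x gx; have [nm|ne] := eqVneq nu mu.
      exists 0; first by split; [exact: (subsp0 hE)|exact: (subsp0 hG)].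
      rewrite (islin0 (islin_shift mu)) sub0r -nm; exact: (subspN (subsp_geneig nu)).
    have [w gw h] := geneig_solve ne gx; exists w => //.
    by split; [case: gw|exact: gG gw].
  - move=> w [Ew Gw]; rewrite -(islinB _ _ (islin_shift mu)).
    move=> /(geneig_shift (subspB hE Ew Eu)) /gG h.
    by rewrite -(subKr w u); exact: (subspB hG).
suff [] : maps T E E /\ E `<=` G by [].
apply: (cod_ind (P := fun h => maps T h h /\ h `<=` G) hF hE FE cFE).
  by split=> // x Fx; apply: (gG 0); split; [exact: FE|exists 0%N].
move=> h hh Fh hE' [Th hG'] hne.
have chE : cod n h E by exact: cod_sub cFE.
have [mu [u [Eu nhu hu]]] := eigenvector_mod Tl hh hE hE' TE chE hne.
have Gu : G u by apply: (solve mu) => //; exact: hG'.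
exists u; split=> //; split; last exact: adj_sub.
move=> x [c hx]; exists (c * mu).
have -> : T x - (c * mu) *: u = T (x - c *: u) + c *: shift_op mu u.
  by rewrite (islinB _ _ Tl) (islinZ _ _ Tl) scalerBr scalerA addrA subrK.
by apply: subspD => //; [exact: Th|exact: subspZ].
Qed.

(** Without nonzero eigenvalues only the generalised eigenspace of 0 reaches outside [F]; finite
    codimension makes the exponent uniform. *)
Lemma nilp_or_eigenvector : (exists m, maps (iter m T) E F) \/
  exists mu u, [/\ mu != 0, E u, ~ F u & F (shift_op mu u)].
Proof.
have [|H] := pselect (exists mu u, [/\ mu != 0, E u, ~ F u & F (shift_op mu u)]).
  by right.
left.
have gF mu : mu != 0 -> geneig mu `<=` F.
  move=> mu0 w [Ew [m]]; elim: m w Ew => [//|m IH] w Ew; rewrite iterSr => Fw.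
  apply: contrapT => nFw; apply: H; exists mu, w; split=> //.
  by apply: IH => //; exact: maps_shift.
pose D i : set X := [set z | E z /\ F (iter i T z)].
have hD i : subsp (D i).
  have il := islin_iter i Tl.
  split; first by split; [exact: (subsp0 hE)|rewrite (islin0 il); exact: (subsp0 hF)].
  move=> c a b [Ea Fa] [Eb Fb]; split; first exact: subspL.
  by rewrite il; exact: subspL.
have Dinc i : D i `<=` D i.+1 by move=> z [Ez Fz]; split=> //; exact: TF.
have FD : F `<=` D 0 by move=> z Fz; split=> //; exact: FE.
have [|d hd] := cod_chain hF hE FE hD Dinc FD cFE.
  apply: geneig_decomp; first exact: subsp_chain.
  move=> mu w; have [->|mu0] := eqVneq mu 0; last first.
    by move=> /(gF _ mu0) /FD Dw; exists 0%N.
  move=> [Ew [m Fw]]; exists m; split=> //.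
  rewrite (_ : T = shift_op 0) //.
  by apply/funext => z; rewrite /shift_op scale0r subr0.
by exists d => z /hd [].
Qed.

End Eigenspaces.

(** * Lie subalgebras of finite codimension *)

Section LieBasics.
Context {R : realType} {L : banachLieType R}.
Implicit Types (M N I D : set L).

Lemma islin_lie (a : L) : islin (lie a).
Proof. by move=> c b b'; rewrite lie_linearr. Qed.

Lemma islin_liel (b : L) : islin (fun a : L => lie a b).
Proof. by move=> c a a'; rewrite lie_linearl. Qed.

Lemma lieDl (a b c : L) : lie (a + b) c = lie a c + lie b c.
Proof. exact: (islinD _ _ (islin_liel c)). Qed.

Lemma lieDr (a b c : L) : lie a (b + c) = lie a b + lie a c.
Proof. exact: (islinD _ _ (islin_lie a)). Qed.

Lemma lieC (a b : L) : lie a b = - lie b a.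
Proof.
have := liexx (a + b); rewrite lieDl !lieDr !liexx add0r addr0.
by move/eqP; rewrite addr_eq0 => /eqP.
Qed.

Lemma lie_der (x y z : L) : lie x (lie y z) = lie (lie x y) z + lie y (lie x z).
Proof.
have := lie_jacobi x y z; rewrite (lieC z x) (islinN _ (islin_lie y)).
rewrite (lieC z (lie x y)) -addrA -opprD => /eqP; rewrite subr_eq0 => /eqP ->.
by rewrite addrC.
Qed.

Lemma lie_derl (x y z : L) : lie (lie x y) z = lie x (lie y z) - lie y (lie x z).
Proof. by rewrite lie_der addrK. Qed.

Definition idealizer M : set L := [set b | maps (lie b) M M].

Lemma idealizer_subalgebra M : subsp M -> lie_subalgebra (idealizer M).
Proof.
move=> hM; split; last first.
  move=> a b ha hb z Mz; rewrite lie_derl.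
  by apply: subspB => //; [exact/ha/hb|exact/hb/ha].
split=> [z Mz|c a b ha hb z Mz].
  by rewrite (islin0 (islin_liel z)); exact: subsp0.
by rewrite lie_linearl; apply: subspL => //; [exact: ha|exact: hb].
Qed.

Lemma sub_idealizer M : lie_subalgebra M -> M `<=` idealizer M.
Proof. by move=> [_ h] x Mx y My; exact: h. Qed.

Lemma lie_ideal_of_idealizer M : subsp M -> idealizer M = setT -> lie_ideal M.
Proof.
move=> hM E; split=> // a b Mb; have h : idealizer M a by rewrite E.
exact: h.
Qed.

Lemma lie_idealW M : lie_ideal M -> lie_subalgebra M.
Proof. by move=> [h1 h2]; split=> // a b _; exact: h2. Qed.

(* The filtration attached to a subalgebra [M]; when [D] together with [M]
   generates the algebra, its intersection is the largest ideal inside [M]. *)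
Fixpoint lfil M D k : set L :=
  if k is k'.+1 then
    [set z | lfil M D k' z /\ forall b, D b -> lfil M D k' (lie b z)]
  else M.

Lemma subsp_lfil M D k : subsp M -> subsp (lfil M D k).
Proof.
move=> hM; elim: k => //= k IH; split.
  split=> [|b _]; first exact: subsp0.
  by rewrite (islin0 (islin_lie b)); exact: subsp0.
move=> c a b [Ua Da] [Ub Db]; split=> [|d Dd]; first exact: subspL.
by rewrite lie_linearr; apply: subspL => //; [exact: Da|exact: Db].
Qed.

Lemma lfil_dec M D k : lfil M D k.+1 `<=` lfil M D k.
Proof. by move=> z []. Qed.

Lemma lfil_sub M D k : lfil M D k `<=` M.
Proof. by elim: k => // k IH z /lfil_dec /IH. Qed.

Lemma lfil_stable M D k y : subsp M -> maps (lie y) M M ->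
  maps (lie y) D D -> maps (lie y) (lfil M D k) (lfil M D k).
Proof.
move=> hM yM yD; elim: k => //= k IH z [Uz Dz]; split; first exact: IH.
have hU := subsp_lfil D k hM.
move=> b Db; rewrite -(subKr (lie y (lie b z)) (lie b (lie y z))) -lie_derl.
by apply: subspB => //; [exact/IH/Dz|exact/Dz/yD].
Qed.

Lemma lfil_max M D k I : lie_ideal I -> I `<=` M -> I `<=` lfil M D k.
Proof.
by move=> [hI II] IM; elim: k => // k IH z Iz; split=> [|b _]; apply: IH => //; exact: II.
Qed.

(** [D] may be infinite-dimensional, but [U] is already stable under [M], so only finitely many
    directions modulo [M] impose conditions, each costing at most the codimension of [U]. *)
Lemma lfil_cod M D k : lie_subalgebra M -> (forall y, M y -> maps (lie y) D D) ->
  (exists n, cod n M setT) -> exists n, cod n (lfil M D k) setT.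
Proof.
move=> [hM MM] MD [n cM]; elim: k => [|k [m cU]]; first by exists n.
set U := lfil M D k in cU.
have hU : subsp U by exact: subsp_lfil.
have MU y : M y -> maps (lie y) U U.
  by move=> My; apply: lfil_stable => //; [move=> z; exact: MM|exact: MD].
pose W S : set L := [set z | U z /\ forall b, S b -> U (lie b z)].
have hW S : subsp (W S).
  split.
    split=> [|b _]; first exact: subsp0.
    by rewrite (islin0 (islin_lie b)); exact: subsp0.
  move=> c a b [Ua Da] [Ub Db]; split=> [|d Dd]; first exact: subspL.
  by rewrite lie_linearr; apply: subspL => //; [exact: Da|exact: Db].
have [p] : exists n, cod n (W setT) setT.
  apply: (cod_ind (P := fun S => exists n, cod n (W S) setT) hM subspT _ cM) => //.
    by exists m; apply: cod_sub cU => // z Uz; split=> // b Mb; exact: MU.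
  move=> h hh _ _ [q cq] [u _ nhu]; exists u; split=> //.
  have := cod_preim (islin_lie u) hU (hW h) cU.
  move=> /cod_trans /(_ cq) => H; exists (m + q)%N.
  apply: cod_sub H => // z [[Uz hz] Uuz]; split=> // b [c hb].
  rewrite -(subrK (c *: u) b) lieDl (islinZ _ _ (islin_liel z)).
  by apply: subspD => //; [exact: hz|exact: subspZ].
by move=> cW; exists p; apply: cod_sub cW => // z [Uz h]; split=> // b _; exact: h.
Qed.

End LieBasics.

(** * Engel's theorem for the action of a subalgebra on the quotient space *)

Section Engel.
Context {R : realType} {L : banachLieType R}.
Implicit Types (M V W h : set L).

(** [[(ad x)^(2m) z, b]] is a combination of terms [(ad x)^p [z, (ad x)^q b]] with [p + q = 2m]. If
    [p >= m] the outer power lands in [M]; if [q >= m] the bracket is between elements of [M]. *)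
Lemma ad_nilp_lfil M x m : lie_subalgebra M -> M x ->
  maps (iter m (lie x)) setT M ->
  maps (iter m.*2 (lie x)) M (lfil M setT 1).
Proof.
move=> [hM MM] Mx xm z Mz.
have Mi p : maps (iter p (lie x)) M M by apply: maps_iter => y; exact: MM.
have iM p y : (m <= p)%N -> M (iter p (lie x) y).
  by move=> mp; rewrite -(subnKC mp) iterD; exact: xm.
have H k p q b : (m.*2 <= p + q + k)%N ->
    M (iter p (lie x) (lie (iter k (lie x) z) (iter q (lie x) b))).
  elim: k p q => [|k IH] p q pq.
    rewrite addn0 in pq; have [mp|pm] := leqP m p; first exact: iM.
    apply: Mi; apply: MM => //; apply: iM.
    rewrite leqNgt; apply/negP => qm; move: pq; rewrite leqNgt -addnn.
    by rewrite (ltn_trans (n := (p + m)%N)) ?ltn_add2l ?ltn_add2r.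
  have il := islin_iter p (islin_lie x).
  rewrite iterS lie_derl (islinB _ _ il) -iterSr -iterS.
  by apply: (subspB hM); apply: IH; move: pq; rewrite !(addSn, addnS).
split=> [|b _]; first exact: Mi.
by rewrite lieC; apply: (subspN hM); apply: (H m.*2 0%N 0%N).
Qed.

Lemma engel M : lie_subalgebra M -> (exists n, cod n M setT) -> M <> setT ->
  (forall x, M x -> exists m, maps (iter m (lie x)) setT M) ->
  exists2 a, ~ M a & forall x, M x -> M (lie x a).
Proof.
move=> Malg cM Mp Mnil; have [hM MM] := Malg.
(* [M1] is the kernel of the action of [M] on [L / M]; the finite-dimensional algebra of Engel's
   theorem is [M / M1]. *)
pose M1 := lfil M setT 1.
have hM1 : subsp M1 by exact: subsp_lfil.
have M1M : M1 `<=` M by exact: lfil_sub.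
have [n cM1] : exists n, cod n M1 setT by exact: lfil_cod.
have {}cM1 : cod n M1 M by exact: cod_sub cM1.
have M1lie x y : M x -> M1 y -> M1 (lie x y).
  by move=> Mx; apply: (lfil_stable (k := 1)) => // z; exact: MM.
(* All pairs [V], [W] are allowed because two different actions occur: on [M / h], to find the next
   vector of the flag, and finally on [L / M]. *)
pose P h := lie_subalgebra h /\ forall V W, subsp V -> subsp W -> W `<=` V ->
  (forall x, h x -> maps (lie x) V V /\ maps (lie x) W W) ->
  (forall x, M1 x -> maps (lie x) V W) ->
  (forall x, h x -> exists m, maps (iter m (lie x)) V W) ->
  nilp (lie @` h) V W.
suff [_ PM] : P M.
  have nM : nilp (lie @` M) setT M.
    apply: PM => // x.
    - by move=> Mx; split=> // y; exact: MM.
    - by move=> [_ h] y _; rewrite lieC; apply: subspN => //; exact: h.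
  have nTM : ~ (setT `<=` M) by move=> h; apply: Mp; apply/seteqP; split.
  have [f [_ nMf Mf]] := nilp_fix nM nTM.
  by exists f => // x Mx; apply: Mf; exists x.
apply: (cod_ind hM1 hM M1M cM1).
  split; first by split=> // x y /M1M; exact: M1lie.
  move=> V W hV hW WV _ h _; exists 1%N => f Vf; split=> // T [x M1x <-].
  exact: h.
move=> h hh M1h hM' [halg Ph] [u0 Mu0 nhu0].
have nh : nilp (lie @` h) M h.
  apply: Ph => // x.
  - move=> hx; split=> y; first by apply: MM; exact: hM'.
    by case: halg => _; apply.
  - by move=> M1x y My; apply: M1h; rewrite lieC; apply: subspN => //; exact: M1lie.
  - move=> hx; have Mx := hM' x hx; have [m xm] := Mnil x Mx.
    by exists m.*2 => y My; apply: M1h; apply: ad_nilp_lfil My.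
have nMh : ~ (M `<=` h) by move=> H; exact/nhu0/H.
have [c [Mc nhc hc]] := nilp_fix nh nMh.
exists c; split=> //.
have hc' x : h x -> h (lie x c) by move=> hx; apply: hc; exists x.
split.
  split; first exact: subsp_adj.
  move=> x y [p hx] [q hy]; apply: sub_adj.
  rewrite -(subrK (p *: c) x) -(subrK (q *: c) y).
  move: (x - p *: c) (y - q *: c) hx hy => {}x {}y hx hy; rewrite lieDl !lieDr.
  rewrite !(islinZ _ _ (islin_liel _)) !(islinZ _ _ (islin_lie _)) liexx.
  rewrite !scaler0 addr0.
  apply: subspD => //; first (apply: subspD => //).
  - by case: halg => _; apply.
  - by apply: subspZ => //; exact: hc'.
  - by apply: subspZ => //; rewrite lieC; apply: subspN => //; exact: hc'.
move=> V W hV hW WV st M1V nl.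
have hadj : h `<=` adj h c by exact: sub_adj.
have cadj : adj h c c by exact: adj_gen.
have [cV cW] := st _ cadj.
apply: (nilp_step (S := lie @` h) hV hW WV _ (islin_lie c) cV cW (nl _ cadj)).
- by move=> T [x hx <-]; have [? ?] := st _ (hadj _ hx); split=> //; exact: islin_lie.
- apply: Ph => // x /hadj; [exact: st|exact: nl].
- move=> T [x hx <-]; exists (lie (lie x c)); first by exists (lie x c) => //; exact: hc'.
  by move=> f _; rewrite lie_derl subrr; exact: subsp0.
- move=> T [x [p hx] <-]; exists (lie (x - p *: c)); first by exists (x - p *: c).
  exists p => f _; rewrite -(islinZ p c (islin_liel f)) -lieDl subrK subrr.
  exact: subsp0.
Qed.

End Engel.

(** * Distance to a subspace *)

(** Distances are infima, which are taken in [R] and not in [R[i]]. *)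
Definition rnorm (R : realType) (V : normedZmodType R[i]) (x : V) : R :=
  complex.Re `|x|.

Section RealNorm.
Context {R : realType}.

Lemma rnormE (V : normedZmodType R[i]) (x : V) : `|x| = (rnorm x)%:C.
Proof. exact: normRe. Qed.

Lemma rnorm_ge0 (V : normedZmodType R[i]) (x : V) : 0 <= rnorm x.
Proof. by rewrite -ler0c -rnormE. Qed.

Lemma rnormD (V : normedZmodType R[i]) (x y : V) :
  rnorm (x + y) <= rnorm x + rnorm y.
Proof. by rewrite -lecR rmorphD /= -!rnormE; exact: ler_normD. Qed.

Lemma rnormN (V : normedZmodType R[i]) (x : V) : rnorm (- x) = rnorm x.
Proof. by rewrite /rnorm normrN. Qed.

Lemma rnorm0 (V : normedZmodType R[i]) : rnorm (0 : V) = 0.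
Proof. by rewrite /rnorm normr0. Qed.

Lemma rnorm_eq0 (V : normedZmodType R[i]) (x : V) : rnorm x = 0 -> x = 0.
Proof. by move=> h; apply/normr0_eq0; rewrite rnormE h. Qed.

Lemma rnormZ (V : normedModType R[i]) (c : R[i]) (x : V) :
  rnorm (c *: x) = rnorm c * rnorm x.
Proof.
apply: (@complexI R); rewrite rmorphM /= -!rnormE.
exact: normrZ.
Qed.

Lemma rnorm_Re (z : R[i]) : `|complex.Re z| <= rnorm z.
Proof. by rewrite -lecR -rnormE normc_ge_Re. Qed.

Lemma rnorm_Im (z : R[i]) : `|complex.Im z| <= rnorm z.
Proof.
by rewrite /rnorm normc_def /= -sqrtr_sqr ler_wsqrtr // lerDr sqr_ge0.
Qed.

Lemma rnorm_le (z : R[i]) : rnorm z <= `|complex.Re z| + `|complex.Im z|.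
Proof.
rewrite /rnorm normc_def /= -[leRHS]ger0_norm ?addr_ge0 // -sqrtr_sqr.
rewrite ler_wsqrtr // sqrrD !real_normK ?num_real // addrAC lerDl.
by rewrite mulrn_wge0 // mulr_ge0.
Qed.

(** The intervals of centre [a i] and radius [e i] meet pairwise, so they have a common point: the
    supremum of the left end points. *)
Lemma real_cauchy (I : Type) (i0 : I) (a e : I -> R) :
  (forall i j, a i - a j <= e i + e j) -> exists l, forall i, `|l - a i| <= e i.
Proof.
move=> h; pose S := range (fun i => a i - e i).
have ubS j : ubound S (a j + e j).
  by move=> _ [i _ <-]; rewrite lerBlDr -addrA (addrC (e j)) -lerBlDl h.
have S0 : S !=set0 by exists (a i0 - e i0), i0.
exists (sup S) => i; rewrite ler_norml lerBlDl lerBrDr addrC.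
apply/andP; split; last exact: ge_sup.
by apply: ub_le_sup; [exists (a i0 + e i0)|exists i].
Qed.

(** The radius doubles because real and imaginary parts are treated separately. *)
Lemma complex_cauchy (I : Type) (i0 : I) (a : I -> R[i]) (e : I -> R) :
  (forall i j, rnorm (a i - a j) <= e i + e j) ->
  exists l, forall i, rnorm (l - a i) <= e i + e i.
Proof.
move=> h.
have [|x hx] := @real_cauchy I i0 (fun i => complex.Re (a i)) e.
  move=> i j; apply: le_trans (h i j); apply: le_trans (rnorm_Re _).
  by rewrite raddfB ler_norm.
have [|y hy] := @real_cauchy I i0 (fun i => complex.Im (a i)) e.
  move=> i j; apply: le_trans (h i j); apply: le_trans (rnorm_Im _).
  by rewrite raddfB ler_norm.
exists (x +i* y) => i; apply: le_trans (rnorm_le _) _.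
by rewrite !raddfB /=; apply: lerD.
Qed.

End RealNorm.

Section Distance.
Context {R : realType} {X : normedModType R[i]}.
Implicit Types (F : set X).

Definition dist F (z : X) : R := inf [set rnorm (z - f) | f in F].

Lemma dist_le F z f : F f -> dist F z <= rnorm (z - f).
Proof.
move=> Ff; apply: ge_inf; last by exists f.
by exists 0 => _ [g _ <-]; exact: rnorm_ge0.
Qed.

Lemma dist_ge F z d : F !=set0 -> (forall f, F f -> d <= rnorm (z - f)) ->
  d <= dist F z.
Proof.
move=> [f Ff] h; apply: lb_le_inf; first by exists (rnorm (z - f)), f.
by move=> _ [g Fg <-]; exact: h.
Qed.

Lemma dist_adh F z e : F !=set0 -> 0 < e ->
  exists2 f, F f & rnorm (z - f) < dist F z + e.
Proof.
move=> [f Ff] e0.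
have [|_ [g Fg <-] h] := inf_adherent e0 (E := [set rnorm (z - f) | f in F]).
  split; first by exists (rnorm (z - f)), f.
  by exists 0 => _ [g _ <-]; exact: rnorm_ge0.
by exists g.
Qed.

Section Subspace.
Variable (F : set X).
Hypothesis (hF : subsp F).

Let F0 : F !=set0. Proof. by exists 0; exact: subsp0. Qed.

Lemma dist_ge0 z : 0 <= dist F z.
Proof. by apply: dist_ge => // f _; exact: rnorm_ge0. Qed.

Lemma dist_norm z : dist F z <= rnorm z.
Proof. by rewrite -{2}(subr0 z); apply: dist_le; exact: subsp0. Qed.

Lemma distD x y : dist F (x + y) <= dist F x + dist F y.
Proof.
apply/ler_addgt0Pr => e e0.
have e2 : 0 < e / 2 by rewrite divr_gt0.
have [f Ff hf] := dist_adh x F0 e2; have [g Fg hg] := dist_adh y F0 e2.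
apply: (le_trans (dist_le _ (subspD hF Ff Fg))).
rewrite opprD addrACA (le_trans (rnormD _ _))//.
by rewrite (splitr e) addrACA lerD ?ltW.
Qed.

Lemma dist_scale_le (c : R[i]) x : dist F (c *: x) <= rnorm c * dist F x.
Proof.
have [->|c0] := eqVneq c 0.
  rewrite scale0r rnorm0 mul0r; apply: (le_trans (dist_norm _)).
  by rewrite rnorm0.
have rc : 0 < rnorm c.
  rewrite lt_def rnorm_ge0 andbT; apply: contra_neq c0; exact: rnorm_eq0.
rewrite mulrC -ler_pdivrMr //; apply: dist_ge => // f Ff.
rewrite ler_pdivrMr // mulrC -rnormZ scalerBr; apply: dist_le; exact: subspZ.
Qed.

Lemma distZ (c : R[i]) x : dist F (c *: x) = rnorm c * dist F x.
Proof.
apply/eqP; rewrite eq_le dist_scale_le /=.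
have [->|c0] := eqVneq c 0; first by rewrite rnorm0 mul0r dist_ge0.
have rc : 0 < rnorm c.
  rewrite lt_def rnorm_ge0 andbT; apply: contra_neq c0; exact: rnorm_eq0.
rewrite -{1}(scale1r x) -(mulVf c0) -scalerA.
rewrite (le_trans (ler_wpM2l (ltW rc) (dist_scale_le _ _)))// mulrA.
rewrite (_ : rnorm c * rnorm c^-1 = 1) ?mul1r//.
apply: (@complexI R); rewrite rmorphM /= -!rnormE -normrM mulfV // normr1.
by [].
Qed.

Lemma dist_eq0 x : F x -> dist F x = 0.
Proof.
move=> Fx; apply/eqP; rewrite eq_le dist_ge0 andbT.
by apply: (le_trans (dist_le x Fx)); rewrite subrr rnorm0.
Qed.

Lemma dist_in x f : F f -> dist F (x + f) = dist F x.
Proof.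
move=> Ff; have h1 := distD x f; have h2 := distD (x + f) (- f).
rewrite addrK (dist_eq0 (subspN hF Ff)) addr0 in h2.
rewrite (dist_eq0 Ff) addr0 in h1.
by apply/eqP; rewrite eq_le h1 h2.
Qed.

Lemma closure_dist x : closure F x -> dist F x = 0.
Proof.
move=> cx; apply/eqP; rewrite eq_le dist_ge0 andbT.
apply/ler_addgt0Pr => e e0; rewrite add0r.
have [|f [Ff]] := cx (ball x e%:C); first by apply: nbhsx_ballx; rewrite ltcR.
rewrite -ball_normE /= => h; apply: (le_trans (dist_le x Ff)).
by rewrite ltW // -ltcR -rnormE.
Qed.

Lemma dist_closed x : closed F -> dist F x = 0 -> F x.
Proof.
move=> cF d0; apply: cF => B /nbhs_ballP[e /= e0 eB].
have [|f Ff hf] := dist_adh x F0 (e := complex.Re e).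
  by rewrite -ltcR RRe_real // gtr0_real.
exists f; split=> //; apply: eB; rewrite -ball_normE /=.
by rewrite rnormE -(RRe_real (gtr0_real e0)) ltcR; move: hf; rewrite d0 add0r.
Qed.

(** If [v] is at positive distance from [F], its coefficient in an approximation of [x] is
    determined up to the error divided by [dist F v], so the coefficients of ever better
    approximations converge. *)
Lemma closed_adj v : closed F -> closed (adj F v).
Proof.
move=> cF; have [Fv|nFv] := pselect (F v).
  rewrite (_ : adj F v = F) //; apply/seteqP; split; last exact: sub_adj.
  exact: adj_sub.
have d0 : 0 < dist F v.
  rewrite lt_def dist_ge0 andbT; apply: contra_not_neq nFv => d0.
  exact: dist_closed.
move=> x cx; pose I := {e : R | 0 < e}.
have /choice[a ha] : forall i : I, exists c : R[i], dist F (x - c *: v) < sval i.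
  case=> e e0 /=; have [|w [[c Fw]]] := cx (ball x e%:C).
    by apply: nbhsx_ballx; rewrite ltcR.
  rewrite -ball_normE /= => h; exists c.
  rewrite -ltcR; apply: le_lt_trans h; rewrite rnormE lecR.
  have := dist_le (x - c *: v) Fw; rewrite opprB addrA subrK.
  by [].
have [|l hl] := @complex_cauchy R I (exist (fun e : R => is_true (0 < e)) 1 ltr01)
  a (fun i => sval i / dist F v).
  move=> i j; rewrite -mulrDl ler_pdivlMr // -distZ.
  rewrite (_ : _ *: v = (x - a j *: v) + (-1) *: (x - a i *: v)); last first.
    by rewrite scaleN1r opprB [RHS]addrC subrKA scalerBl.
  rewrite (le_trans (distD _ _))// distZ (_ : rnorm (-1) = 1) ?mul1r; last first.
    by rewrite rnormN /rnorm normr1.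
  by rewrite addrC lerD // ltW.
exists l; apply: dist_closed => //; apply/eqP; rewrite eq_le dist_ge0 andbT.
apply/ler_addgt0Pr => e e0; rewrite add0r.
(* The limit coefficient is off by at most [2 * (e / 3) / dist F v], costing [2 * (e / 3)] on top of
   the error [e / 3] of the approximation. *)
have i0 : 0 < e / 3 by rewrite divr_gt0.
pose i : I := exist (fun e : R => is_true (0 < e)) (e / 3) i0.
rewrite (_ : x - l *: v = (x - a i *: v) + (- (l - a i)) *: v); last first.
  by rewrite opprB scalerBl addrA subrK.
rewrite (le_trans (distD _ _))// distZ rnormN.
have -> : e = e / 3 + (e / 3 + e / 3) by lra.
apply: lerD; first exact: ltW (ha i).
rewrite -ler_pdivlMr // mulrDl; exact: hl i.
Qed.

End Subspace.

Lemma closed_subsp n (M N : set X) : subsp M -> closed M -> cod n M setT -> subsp N ->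
  M `<=` N -> closed N.
Proof.
move=> hM cM fM hN MN.
apply: (cod_ind (P := @closed X) hM hN MN) => //.
  by apply: cod_sub fM.
by move=> h hh _ _ ch [u Nu nhu]; exists u; split=> //; exact: closed_adj.
Qed.

End Distance.

Section Spectrum.
Context {R : realType} {L : banachLieType R}.

(** The distance to [F] is a norm on [L / F] for which [ad x] is bounded by [t * rnorm x]. It
    matters that [C] is chosen before [F]. *)
Lemma bounded_spectrum (x : L) : exists C : R, forall F : set L,
  subsp F -> closed F -> maps (lie x) F F -> forall nu z, C < rnorm nu ->
  F (shift_op (lie x) nu z) -> F z.
Proof.
have [t t0 ht] := @lie_bounded R L; exists (t * rnorm x) => F hF cF xF nu z Cnu Fz.
have n0 : 0 < rnorm nu by apply: le_lt_trans Cnu; rewrite mulr_ge0 ?rnorm_ge0// ltW.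
have nu0 : nu != 0 by apply: contraTneq n0 => ->; rewrite rnorm0 ltxx.
have le_dist : rnorm nu * dist F z <= t * rnorm x * dist F z.
  apply/ler_addgt0Pr => e e0.
  have [e1 e10 he1] : exists2 e1, 0 < e1 & t * rnorm x * e1 <= e.
    exists (e / (t * rnorm x + 1)).
      by rewrite divr_gt0 // ltr_wpDl // mulr_ge0 ?rnorm_ge0 ?ltW.
    rewrite mulrA ler_pdivrMr; last by rewrite ltr_wpDl // mulr_ge0 ?rnorm_ge0 ?ltW.
    by rewrite mulrC ler_pM2l // lerDl.
  have [|f Ff hf] := dist_adh z (F := F) _ e10; first by exists 0; exact: subsp0.
  rewrite -distZ //.
  rewrite (_ : nu *: z = lie x (z - f) + (lie x f - shift_op (lie x) nu z)); last first.
    by rewrite (islinB _ _ (islin_lie x)) addrA subrK /shift_op opprB addrC subrK.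
  rewrite dist_in //; last by apply: subspB => //; exact: xF.
  apply: (le_trans (dist_norm hF _)).
  have := ht x (z - f); rewrite !rnormE -!rmorphM lecR => /le_trans; apply.
  apply: le_trans (lerD (lexx _) he1); rewrite -mulrDr.
  apply: ler_wpM2l; last exact: ltW hf.
  by rewrite mulr_ge0 ?rnorm_ge0 // ltW.
apply: dist_closed => //; apply/eqP; rewrite eq_le dist_ge0 // andbT leNgt.
apply/negP => d0; move: le_dist; rewrite ler_pM2r // leNgt Cnu.
by [].
Qed.

Lemma islin_closed_preim (X Y : normedModType R[i]) (T : X -> Y) (k : R)
  (F : set Y) : islin T -> (forall x, rnorm (T x) <= k * rnorm x) ->
  closed F -> closed (T @^-1` F).
Proof.
move=> Tl Tk cF x cx; apply: cF => B /nbhs_ballP[e /= e0 eB].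
have er : e = (complex.Re e)%:C by rewrite RRe_real // gtr0_real.
have e0r : 0 < complex.Re e by rewrite -ltcR -er.
have k0 : 0 < `|k| + 1 by rewrite ltr_wpDl.
have [|y [Fy]] := cx (ball x (complex.Re e / (`|k| + 1))%:C).
  by apply: nbhsx_ballx; rewrite ltcR divr_gt0.
rewrite -ball_normE /= rnormE ltcR ltr_pdivlMr // => h.
exists (T y); split=> //; apply: eB; rewrite -ball_normE /= -(islinB _ _ Tl).
rewrite er rnormE ltcR; apply: le_lt_trans h; apply: (le_trans (Tk _)).
rewrite mulrC ler_wpM2l ?rnorm_ge0 //.
by rewrite (le_trans (ler_norm k)) // lerDl.
Qed.

Lemma closed_lie_preim (b : L) (F : set L) : closed F -> closed (lie b @^-1` F).
Proof.
have [t t0 ht] := @lie_bounded R L.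
apply: (islin_closed_preim (k := t * rnorm b) (islin_lie b)) => x.
by have := ht b x; rewrite !rnormE -!rmorphM lecR.
Qed.

End Spectrum.

(** * Weisfeiler's filtration *)

Lemma cod_image (K : fieldType) (X Y : lmodType K) (T : X -> Y) n
  (M S : set X) (F : set Y) : islin T -> (forall x, M x -> F (T x)) ->
  cod n M S -> cod n F (T @` S).
Proof.
move=> Tl; elim: n M F => [|n IH] M F MF; first by move=> SM _ [x /SM /MF ? <-].
rewrite !codS => -[v cv]; exists (T v); apply: IH cv => x [c Mx]; exists c.
by rewrite -(islinZ _ _ Tl) -(islinB _ _ Tl); exact: MF.
Qed.

Section Filtration.
Context {R : realType} {L : banachLieType R} (M : set L) (a : L).
Hypotheses (Malg : lie_subalgebra M).

Let hM : subsp M. Proof. by case: Malg. Qed.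

(** The [M]-submodule generated by [M] and [a], encoded impredicatively so that membership is an
    induction principle. *)
Definition dgen : set L := [set b | forall Z : set L, subsp Z -> M `<=` Z ->
  Z a -> (forall y, M y -> maps (lie y) Z Z) -> Z b].

(** The degree of [dneg i] is [- i.+1], in accordance with [Negz i]. *)
Fixpoint dneg (i : nat) : set L :=
  if i is i'.+1 then [set b | forall Z : set L, subsp Z -> dneg i' `<=` Z ->
    (forall u w, dgen u -> dneg i' w -> Z (lie u w)) -> Z b]
  else dgen.

(* Weisfeiler's filtration of the pair [(L, M)]: [fil 0 = M] and
   [fil (- 1) = dgen]. *)
Definition fil (k : int) : set L :=
  match k with Posz j => lfil M dgen j | Negz j => dneg j end.

Lemma subsp_dgen : subsp dgen.
Proof.
split=> [Z hZ _ _ _|c u v hu hv Z hZ MZ Za MZZ]; first exact: subsp0.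
by apply: subspL => //; [exact: hu|exact: hv].
Qed.

Lemma subsp_dneg i : subsp (dneg i).
Proof.
case: i => [|i]; first exact: subsp_dgen.
split=> [Z hZ _ _|c u v hu hv Z hZ Z1 Z2]; first exact: subsp0.
by apply: subspL => //; [exact: hu|exact: hv].
Qed.

Lemma subsp_fil k : subsp (fil k).
Proof. by case: k => j; [exact: subsp_lfil|exact: subsp_dneg]. Qed.

Lemma sub_dgen : M `<=` dgen.
Proof. by move=> x Mx Z _ MZ _ _; exact: MZ. Qed.

Lemma dgen_a : dgen a.
Proof. by move=> Z. Qed.

Lemma fil_decS k : fil (k + 1) `<=` fil k.
Proof.
case: k => [j|[|j]].
- by rewrite (_ : Posz j + 1 = Posz j.+1); [exact: (@lfil_dec _ _ M dgen j)|lia].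
- exact: sub_dgen.
- rewrite (_ : Negz j.+1 + 1 = Negz j); last lia.
  by move=> x hx Z _ h _; exact: h.
Qed.

Lemma fil_dec k l : k <= l -> fil l `<=` fil k.
Proof.
move=> kl; have -> : l = k + (`|l - k|%N)%:Z by lia.
elim: `|l - k|%N => [|m IH]; first by rewrite addr0.
by move=> x; rewrite (_ : k + m.+1%:Z = k + m%:Z + 1); [move/fil_decS/IH|lia].
Qed.

Lemma dgen_lie y : M y -> maps (lie y) dgen dgen.
Proof. by move=> My b hb Z hZ MZ Za MZZ; exact: (MZZ y My b (hb Z hZ MZ Za MZZ)). Qed.

Lemma fil_lie0 y k : M y -> maps (lie y) (fil k) (fil k).
Proof.
move=> My; case: k => [j|j]; rewrite /fil.
  apply: lfil_stable => //; last exact: dgen_lie.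
  by case: Malg => _ h z; exact: h.
elim: j => [|j IH] b hb; first exact: dgen_lie.
apply: (hb [set b | dneg j.+1 (lie y b)]).
- exact: (subsp_preim (islin_lie y) (subsp_dneg j.+1)).
- by move=> w /IH hw Z _ h _; exact: h.
- move=> u w hu hw; rewrite /= lie_der.
  apply: (subspD (subsp_dneg j.+1)) => Z _ _ h; apply: h => //.
    exact: dgen_lie.
  exact: IH.
Qed.

Lemma fil_lie1 k u z : dgen u -> fil k z -> fil (k - 1) (lie u z).
Proof.
move=> hu; case: k => [[|j]|j] hz.
- by rewrite lieC; apply: (subspN (subsp_fil (-1))); exact: dgen_lie.
- by rewrite (_ : Posz j.+1 - 1 = Posz j); [case: hz => _; apply|lia].
- rewrite (_ : Negz j - 1 = Negz j.+1); last lia.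
  by move=> Z _ _ h; exact: h.
Qed.

(** Induction on the generation of [fil (- i)]: by the Jacobi identity a bracket of generators acts
    as a difference of composites, whose shifts add up. *)
Lemma fil_lie i k u z : fil (- i%:Z) u -> fil k z -> fil (k - i%:Z) (lie u z).
Proof.
elim: i k u z => [|i IH] k u z.
  by move=> Mu fz; rewrite subr0; exact: (@fil_lie0 u k Mu z fz).
rewrite -NegzE; case: i IH => [|i] IH.
  exact: fil_lie1.
move=> hu hz; apply: (hu [set u | forall k z, fil k z -> fil (k - i.+2%:Z) (lie u z)]) => //.
- split=> [k' z' _|c b b' hb hb' k' z' hz'].
    rewrite (islin0 (islin_liel z')); exact: (subsp0 (subsp_fil _)).
  by rewrite lie_linearl; apply: (subspL c (subsp_fil _)); [exact: hb|exact: hb'].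
- move=> w hw k' z' hz'; apply: (@fil_dec _ (k' - i.+1%:Z)); first lia.
  by apply: IH => //; rewrite -NegzE.
- move=> v w hv hw k' z' hz'; rewrite lie_derl.
  have hw' : fil (- i.+1%:Z) w by rewrite -NegzE.
  apply: (subspB (subsp_fil _)).
    rewrite (_ : k' - _ = (k' - i.+1%:Z) - 1); last lia.
    by apply: fil_lie1 => //; exact: IH.
  rewrite (_ : k' - _ = (k' - 1) - i.+1%:Z); last lia.
  by apply: IH => //; exact: fil_lie1.
Qed.

Lemma fil_sub i : M `<=` fil (- i%:Z).
Proof. by apply: (@fil_dec (- i%:Z) 0); lia. Qed.

(** The union of the negative part is a subalgebra strictly containing [M], hence everything, and
    finite codimension makes the ascending chain stop. *)
Lemma fil_exhausts : ~ M a ->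
  (forall N, lie_subalgebra N -> M `<=` N -> (exists2 u, N u & ~ M u) ->
     N = setT) ->
  (exists n, cod n M setT) -> exists d, fil (- d%:Z) = setT.
Proof.
move=> nMa Mmax [n cM].
pose D i := fil (- i%:Z).
have hD i : subsp (D i) by exact: subsp_fil.
have Dinc i : D i `<=` D i.+1 by apply: fil_dec; lia.
have [|||d hd] := cod_chain hM (@subspT _ L) _ hD Dinc _ cM => //.
  suff E : [set x | exists i, D i x] = setT.
    by move=> x _; have : [set x | exists i, D i x] x by rewrite E.
  apply: Mmax.
  - split; first exact: subsp_chain.
    move=> u v [i Du] [j Dv]; exists (i + j)%N.
    rewrite /D (_ : - (i + j)%N%:Z = - j%:Z - i%:Z); last lia.
    exact: fil_lie.
  - by move=> u Mu; exists 0%N.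
  - by exists a => //; exists 1%N; exact: dgen_a.
by exists d; apply/seteqP; split.
Qed.

Lemma closed_lfil (D : set L) k : closed M -> closed (lfil M D k).
Proof.
move=> cM; elim: k => [//|k IH] z cz.
have Uz : lfil M D k z by apply: IH; apply: closure_subset cz => x [].
split=> // b Db; apply: (closed_lie_preim (b := b) IH).
by apply: closure_subset cz => x [_]; apply.
Qed.

Lemma closed_fil k : closed M -> (exists n, cod n M setT) -> closed (fil k).
Proof.
move=> cM [n hn]; case: k => j; first exact: closed_lfil.
apply: (closed_subsp hM cM hn (subsp_dneg j)).
exact: (@fil_sub j.+1).
Qed.

Lemma cod_fil k : (exists n, cod n M setT) -> exists n, cod n (fil k) setT.
Proof.
move=> cM; case: k => j; first exact: (lfil_cod j Malg dgen_lie cM).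
have [n hn] := cM; exists n; apply: cod_sub hn => //.
exact: (@fil_sub j.+1).
Qed.

Section Eigenvector.
Variables (x : L) (lam : R[i]).
Hypotheses (Mx : M x) (lam0 : lam != 0) (xa : M (lie x a - lam *: a)).

(** Since [[x, a] - lam a] lies in [M] and so preserves [fil k], modulo [fil k] the operator [ad a]
    intertwines [ad x - mu] with [ad x - (mu + lam)]. *)
Lemma lie_shift_iter k mu m w : fil k w ->
  fil k (iter m (shift_op (lie x) (mu + lam)) (lie a w) -
         lie a (iter m (shift_op (lie x) mu) w)).
Proof.
have hk := subsp_fil k.
have sx nu := maps_shift nu hk (@fil_lie0 x k Mx).
elim: m w => [|m IH] w fw; first by rewrite subrr; exact: subsp0.
rewrite !iterSr.
have -> : shift_op (lie x) (mu + lam) (lie a w) =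
    lie (lie x a - lam *: a) w + lie a (shift_op (lie x) mu w).
  rewrite /shift_op lie_der lieDl (islinN _ (islin_liel w)).
  rewrite (islinZ _ _ (islin_liel w)) (islinB _ _ (islin_lie a)).
  rewrite (islinZ _ _ (islin_lie a)) [RHS]addrACA -opprD.
  by rewrite addrC scalerDl [in RHS]addrC (addrC (mu *: _)).
have il := islin_iter m (islin_shift (mu + lam) (islin_lie x)).
rewrite (islinD _ _ il) -addrA; apply: (subspD hk).
  by apply: maps_iter (sx _) _ _; exact: fil_lie0.
by apply: IH; exact: sx.
Qed.

(* [ad a] shifts the eigenvalues of [ad x] on the graded pieces by [lam],
   and these eigenvalues are bounded. *)
Lemma ad_nilpotent : closed M -> (exists n, cod n M setT) ->
  exists N, forall k z, fil k z -> fil (k - N%:Z + 1) (iter N (lie a) z).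
Proof.
move=> Mcl cM; have [C specC] := bounded_spectrum x.
have spec k nu m z : C < rnorm nu -> fil k (iter m (shift_op (lie x) nu) z) -> fil k z.
  move=> Cnu; elim: m z => [//|m IH] z; rewrite iterSr => /IH.
  exact: (specC _ (subsp_fil k) (@closed_fil k Mcl cM) (@fil_lie0 x k Mx) _ _ Cnu).
have l0 : 0 < rnorm lam.
  rewrite lt_def rnorm_ge0 andbT; apply: contra_neq lam0; exact: rnorm_eq0.
(* An eigenvalue of modulus at most [C], moved by [N] times [lam], has modulus above [C], which
   [spec] excludes. *)
have [N hN] : exists N : nat, C + C < N%:R * rnorm lam.
  exists (Num.bound ((`|C| + `|C|) / rnorm lam)).
  rewrite -ltr_pdivrMr //; apply: (le_lt_trans _ (archi_boundP _)).
    by rewrite ler_pM2r ?invr_gt0 // lerD // ler_norm.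
  by rewrite divr_ge0 ?addr_ge0 ?rnorm_ge0.
exists N => k z fz.
have [n cn] := @cod_fil (k + 1) cM.
have ck : cod n (fil (k + 1)) (fil k) by exact: cod_sub cn.
pose Z : set L := [set z | fil (k - N%:Z + 1) (iter N (lie a) z)].
have Zlin := islin_iter N (islin_lie a).
have hZ : subsp Z by exact: (subsp_preim Zlin (subsp_fil _)).
have xk l : maps (lie x) (fil l) (fil l) by exact: fil_lie0.
have ga : fil (- 1%:Z) a by exact: dgen_a.
have aj j l w : fil l w -> fil (l - j%:Z) (iter j (lie a) w).
  elim: j => [|j IH]; first by rewrite subr0.
  move=> /IH fw; rewrite iterS (_ : l - j.+1%:Z = (l - j%:Z) - 1%:Z); last lia.
  exact: fil_lie.
have FZ : fil (k + 1) `<=` Z.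
  by move=> w /(aj N); rewrite /Z /= (_ : k + 1 - N%:Z = k - N%:Z + 1); [|lia].
apply: (geneig_decomp (islin_lie x) (subsp_fil (k + 1)) (subsp_fil k)
  (@fil_decS k) (xk (k + 1)) (xk k) ck hZ) fz => mu w [fw [m hm]].
have [Cmu|muC] := ltP C (rnorm mu); first by apply: FZ; exact: spec hm.
have H j : fil (k - j%:Z) (iter j (lie a) w) /\
    fil (k - j%:Z + 1) (iter m (shift_op (lie x) (mu + j%:R * lam)) (iter j (lie a) w)).
  elim: j => [|j [IH1 IH2]]; first by rewrite subr0 mul0r addr0.
  have kj : k - j.+1%:Z = (k - j%:Z) - 1%:Z by lia.
  split; first by rewrite kj iterS; exact: fil_lie.
  rewrite kj subrK -natr1 mulrDl mul1r addrA iterS.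
  have h1 := lie_shift_iter (mu + j%:R * lam) m IH1.
  rewrite -(subrK (lie a (iter m (shift_op (lie x) (mu + j%:R * lam)) (iter j (lie a) w)))
    (iter m _ _)).
  apply: (subspD (subsp_fil _)) => //.
  rewrite (_ : k - j%:Z = k - j%:Z + 1 - 1%:Z); last lia.
  exact: fil_lie.
have [_ hN'] := H N; apply: spec hN'.
have := rnormD (mu + N%:R * lam) (- mu); rewrite addrAC subrr add0r rnormN => h.
have e1 : rnorm (N%:R * lam) = N%:R * rnorm lam.
  by apply: (@complexI R); rewrite rmorphM /= -!rnormE normrM normr_nat rmorph_nat.
rewrite e1 in h; lra.
Qed.

End Eigenvector.
End Filtration.

(** * The largest ideal inside a maximal closed subalgebra *)

Section LargestIdeal.
Context {R : realType} {L : banachLieType R} (M : set L).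
Hypotheses (Malg : lie_subalgebra M) (Mcl : closed M)
  (cM : exists n, cod n M setT) (Mproper : M <> setT)
  (Mmax : forall N : set L, lie_subalgebra N -> M `<=` N ->
     (exists2 u, N u & ~ M u) -> N = setT).

Let hM : subsp M. Proof. by case: Malg. Qed.

(* [v], seen as an operator of degree [- i] on families [f] with
   [f k] in [fil k]. *)
Definition fam_act (i : nat) (v : L) : (int -> L) -> int -> L :=
  fun f k => lie v (f (k + i%:Z)).

Lemma islin_fam_act_arg i : islin (fam_act i).
Proof.
move=> c v v'; apply/funext => f; apply/funext => k.
exact: lie_linearl.
Qed.

Lemma islin_fam_act i v : islin (fam_act i v).
Proof. by move=> c f g; apply/funext => k; exact: lie_linearr. Qed.

Lemma opcomm_fam_act i j u v :
  opcomm (fam_act i u) (fam_act j v) = fam_act (i + j) (lie u v).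
Proof.
apply/funext => f; apply/funext => k; rewrite /fam_act lie_derl.
rewrite (_ : k + (i + j)%N%:Z = k + i%:Z + j%:Z); last lia.
rewrite -[LHS]/(lie u (lie v (f (k + i%:Z + j%:Z))) -
               lie v (lie u (f (k + j%:Z + i%:Z)))).
by rewrite (addrAC k).
Qed.

Lemma lfil_stationary x a lam : M x -> ~ M a -> lam != 0 ->
  M (lie x a - lam *: a) ->
  exists k, lfil M (dgen M a) k `<=` lfil M (dgen M a) k.+1.
Proof.
move=> Mx nMa lam0 xa.
have [N hN] := ad_nilpotent Malg Mx lam0 xa Mcl cM.
have [d hd] := fil_exhausts Malg nMa Mmax cM.
pose D i := fil M a (- i%:Z).
have hfil k : subsp (fil M a k) by exact: subsp_fil.
have D1 : D 1%N = dgen M a by [].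
pose n i : set ((int -> L) -> (int -> L)) := fam_act i @` D i.
(* [V / W] is the product of the graded pieces [fil k / fil (k + 1)]. *)
pose V : set (int -> L) := [set f | forall k, fil M a k (f k)].
pose W : set (int -> L) := [set f | forall k, fil M a (k + 1) (f k)].
have hV : subsp V.
  split=> [k|c f g Vf Vg k]; first exact: (subsp0 (hfil k)).
  by apply: (subspL c (hfil k)); [exact: Vf|exact: Vg].
have hW : subsp W.
  split=> [k|c f g Vf Vg k]; first exact: (subsp0 (hfil _)).
  by apply: (subspL c (hfil _)); [exact: Vf|exact: Vg].
have WV : W `<=` V by move=> f Wf k; apply: fil_decS; exact: Wf.
have lieD i u k z : D i u -> fil M a (k + i%:Z) z -> fil M a k (lie u z).
  by move=> Du fz; have := fil_lie Malg Du fz; rewrite addrK.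
have nst i T : n i T -> stab V W T.
  move=> [u Du <-]; split; first exact: islin_fam_act.
    by move=> f Vf k; apply: (lieD i); [exact: Du|exact: Vf].
  move=> f Wf k; apply: (lieD i); first exact: Du.
  by rewrite addrAC; exact: Wf.
have nilpD1 : nilp (n 1%N) V W.
  apply: (@graded_nilp _ _ n (fam_act 1 a) V W _ _ _ _ _ _ _ _ _ d) => //.
  - by move=> i T /nst [].
  - move=> i; split; first exists 0; first exact: (subsp0 (hfil _)).
      exact: (islin0 (islin_fam_act_arg i)).
    move=> c _ _ [u Du <-] [v Dv <-]; exists (c *: u + v).
      exact: (subspL c (hfil _)).
    exact: islin_fam_act_arg.
  - move=> i j _ _ [u Du <-] [v Dv <-]; rewrite opcomm_fam_act.
    exists (lie u v) => //; apply: (lieD i) => //.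
    by rewrite (_ : _ + _ = - j%:Z); [|lia].
  - by exists a => //; exact: dgen_a.
  - move=> Z hZ trivZ Za MZ _ [v Dv <-].
    suff [] : dgen M a v /\ Z (fam_act 1 v) by [].
    apply: (Dv [set v | dgen M a v /\ Z (fam_act 1 v)]).
    + split; first split; first exact: (subsp0 (hfil (-1))).
        by rewrite (islin0 (islin_fam_act_arg 1)); exact: subsp0.
      move=> c u w [du Zu] [dw Zw]; split; first exact: (subspL c (hfil (-1))).
      by rewrite islin_fam_act_arg; exact: subspL.
    + move=> y My; have dy : dgen M a y by exact: sub_dgen.
      split=> //; apply: trivZ; first by exists y.
      by move=> f Vf k; exact: (fil_lie0 Malg My).
    + by split=> //; exact: dgen_a.
    + move=> y My w [dw Zw]; split; first exact: dgen_lie.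
      rewrite -[1%N]add0n -opcomm_fam_act; apply: MZ => //; first by exists y.
      by exists w.
  - move=> i Z hZ trivZ Zc _ [v Dv <-].
    apply: (Dv [set v | Z (fam_act i.+2 v)]).
    + exact: (subsp_preim (islin_fam_act_arg _) hZ).
    + move=> w hw; have Dw : D i.+1 w by exact: hw.
      apply: trivZ.
        by exists w => //; apply: (fil_dec (l := - i.+1%:Z)) => //; lia.
      move=> f Vf k; apply: (lieD i.+1) => //.
      by rewrite (_ : k + 1 + i.+1%:Z = k + i.+2%:Z); [exact: Vf|lia].
    + move=> u w hu hw; rewrite -[i.+2]add1n /= -opcomm_fam_act.
      by apply: Zc; [exists u|exists w].
  - move=> i; have [m cm] := cM; exists m.
    apply: (cod_image (islin_fam_act_arg i.+1) (M := M)).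
      move=> y My; split; first by exists y => //; exact: fil_sub.
      move=> f Vf k; apply: (fil_lie0 Malg My).
      by apply: (fil_dec (l := k + i.+1%:Z)); [lia|exact: Vf].
    exact: cod_sub cm.
  (* Every [v] lies in [fil (- d)], so a bracket with it lowers the degree by at most [d]; counted
     as an operator of degree [- i] with [i > d], it is trivial. *)
  - move=> i T di [v _ <-] f Vf k.
    have Dv : D d v by rewrite /D hd.
    apply: (lieD d) => //.
    by apply: (fil_dec (l := k + i%:Z)); [lia|exact: Vf].
  - exists N => f Vf k.
    have -> : forall p, iter p (fam_act 1 a) f = fun k => iter p (lie a) (f (k + p%:Z)).
      elim=> [|p IH]; first by apply/funext => l; rewrite addr0.
      rewrite iterS IH; apply/funext => l; rewrite /fam_act iterS.
      by rewrite (_ : l + 1%:Z + p%:Z = l + p.+1%:Z); [|lia].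
    by have := hN _ _ (Vf (k + N%:Z)); rewrite addrK.
have [K hK] := nilpD1; exists K.
(* Transitivity, built into [lfil]: an element of degree [j.+1] whose brackets with [dgen M a] all
   lie one degree deeper than expected lies one degree deeper itself. The bound [p <= j] keeps the
   [p] brackets in the degrees where this holds. *)
have H p f : iter p (ann (n 1%N) V) W f -> forall j : nat, (p <= j)%N ->
    fil M a j.+1 (f j).
  elim: p f => [|p IH] f /=.
    by move=> Wf j _; have := Wf j; rewrite (_ : j%:Z + 1 = j.+1%:Z); [|lia].
  move=> [Vf nf] [//|j] pj; split; first exact: (Vf j.+1).
  move=> b db; have := IH _ (nf (fam_act 1 b) _) j pj.
  rewrite /fam_act (_ : j%:Z + 1%:Z = j.+1%:Z); last lia.
  by apply; exists b.
move=> z Kz.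
pose f : int -> L := fun k => if k == K%:Z then z else 0.
have Vf : V f.
  move=> k; rewrite /f; case: eqP => [->|_] //; exact: (subsp0 (hfil _)).
by have := H K f (hK f Vf) K (leqnn K); rewrite /f eqxx.
Qed.

Theorem largest_ideal : exists I : set L,
  [/\ lie_ideal I, closed I, exists n, cod n I setT, I `<=` M &
      forall J : set L, lie_ideal J -> J `<=` M -> J `<=` I].
Proof.
have [[x [a [lam [Mx nMa lam0 xa]]]]|noeig] := pselect (exists x a lam,
    [/\ M x, ~ M a, lam != 0 & M (lie x a - lam *: a)]).
  have [k hk] := lfil_stationary Mx nMa lam0 xa.
  have hU := subsp_lfil (dgen M a) k hM.
  exists (lfil M (dgen M a) k); split.
  (* Stationarity puts [a] into the idealizer, which also contains [M] and is therefore
     everything. *)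
  - apply: lie_ideal_of_idealizer => //; apply: Mmax.
    + exact: idealizer_subalgebra.
    + by move=> y My; exact: (@fil_lie0 _ _ _ a Malg y k My).
    + exists a => // z /hk [_]; apply; exact: dgen_a.
  - exact: closed_lfil.
  - exact: (lfil_cod k Malg (@dgen_lie _ _ M a) cM).
  - exact: lfil_sub.
  - by move=> J hJ JM; exact: lfil_max.
have Mnil x : M x -> exists m, maps (iter m (lie x)) setT M.
  move=> Mx; have [n cn] := cM.
  have xM : maps (lie x) M M by case: Malg => _ h y; exact: h.
  have xT : maps (lie x) setT setT by [].
  have [//|[mu [u [mu0 _ nMu Mu]]]] := nilp_or_eigenvector (islin_lie x) hM
    (@subspT _ L) (fun _ _ => I) xM xT cn.
  by exfalso; apply: noeig; exists x, u, mu.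
have [a nMa Ma] := engel Malg cM Mproper Mnil.
exists M; split=> //; apply: lie_ideal_of_idealizer => //; apply: Mmax.
- exact: idealizer_subalgebra.
- exact: sub_idealizer.
- exists a => // y My; rewrite lieC; apply: subspN => //; exact: Ma.
Qed.

End LargestIdeal.

(** * Quotients by closed ideals of finite codimension *)

Record fc_ideal (R : realType) (L : banachLieType R) := FcIdeal {
  fc_set :> set L;
  fc_is_ideal : lie_ideal fc_set;
  fc_closed : closed fc_set;
  fc_cod : exists n, cod n fc_set setT
}.

Lemma dist_anti (R : realType) (X : normedModType R[i]) (F E : set X) z :
  F !=set0 -> F `<=` E -> dist E z <= dist F z.
Proof. by move=> F0 FE; apply: dist_ge => // f /FE; exact: dist_le. Qed.

Section Quotient.
Context {R : realType} {L : banachLieType R} (I : fc_ideal L).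

Local Notation J := (fc_set I).

Definition quot := {A : set L | exists x, A = [set y | J (y - x)]}.

Definition qpi (x : L) : quot :=
  exist _ [set y | J (y - x)] (ex_intro _ x erefl).

Definition qrepr (q : quot) : L := projT1 (cid (proj2_sig q)).

Let hI : subsp J. Proof. by case: (fc_is_ideal I). Qed.

Lemma qpi_eq x y : J (x - y) -> qpi x = qpi y.
Proof.
move=> Ixy; apply: eq_exist; apply/seteqP; split=> z /= h.
  by rewrite -(subrKA x); exact: subspD.
rewrite -(subrKA y); apply: (subspD hI h).
by rewrite -opprB; exact: subspN.
Qed.

Lemma qreprK q : qpi (qrepr q) = q.
Proof.
case: q => A hA; apply: eq_exist; rewrite /qrepr /=.
by case: (cid hA).
Qed.

Lemma qpi_inj x y : qpi x = qpi y -> J (x - y).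
Proof.
move=> /(congr1 sval) /= h.
by have : [set z | J (z - x)] x; [rewrite /= subrr; exact: subsp0|rewrite h].
Qed.

Lemma qrepr_pi x : J (qrepr (qpi x) - x).
Proof. by apply: qpi_inj; rewrite qreprK. Qed.

HB.instance Definition _ := gen_eqMixin quot.
HB.instance Definition _ := gen_choiceMixin quot.

Definition qadd p q := qpi (qrepr p + qrepr q).
Definition qscale c q := qpi (c *: qrepr q).
Definition qzero := qpi 0.
Definition qopp q := qpi (- qrepr q).
Definition qlie p q := qpi (lie (qrepr p) (qrepr q)).
Definition qnorm q : R[i] := (dist J (qrepr q))%:C.

Lemma qaddE x y : qadd (qpi x) (qpi y) = qpi (x + y).
Proof. by apply: qpi_eq; rewrite opprD addrACA; apply: subspD => //; exact: qrepr_pi. Qed.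

Lemma qscaleE c x : qscale c (qpi x) = qpi (c *: x).
Proof. by apply: qpi_eq; rewrite -scalerBr; apply: subspZ => //; exact: qrepr_pi. Qed.

Lemma qoppE x : qopp (qpi x) = qpi (- x).
Proof. by apply: qpi_eq; rewrite -opprD; apply: subspN => //; exact: qrepr_pi. Qed.

Lemma fc_liel a b : J a -> J (lie a b).
Proof.
move=> Ia; rewrite lieC; apply: subspN => //.
by case: (fc_is_ideal I) => _; apply.
Qed.

Lemma fc_lier a b : J b -> J (lie a b).
Proof. by move=> Ib; case: (fc_is_ideal I) => _; apply. Qed.

Lemma fc_lieB x y x' y' : J (x - x') -> J (y - y') -> J (lie x y - lie x' y').
Proof.
move=> hx hy; rewrite -(subrKA (lie x' y)).
apply: (subspD hI).
  by rewrite -(islinB _ _ (islin_liel y)); exact: fc_liel.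
by rewrite -(islinB _ _ (islin_lie x')); exact: fc_lier.
Qed.

Lemma qlieE x y : qlie (qpi x) (qpi y) = qpi (lie x y).
Proof. by apply: qpi_eq; apply: fc_lieB; exact: qrepr_pi. Qed.

Lemma qnormE x : qnorm (qpi x) = (dist J x)%:C.
Proof.
rewrite /qnorm; congr (_%:C).
by rewrite -(subrKC x (qrepr (qpi x))) dist_in //; exact: qrepr_pi.
Qed.

Lemma qaddA : associative qadd.
Proof.
move=> p q r; rewrite -(qreprK p) -(qreprK q) -(qreprK r).
by rewrite !qaddE addrA.
Qed.
Lemma qaddC : commutative qadd.
Proof. by move=> p q; rewrite -(qreprK p) -(qreprK q) !qaddE addrC. Qed.
Lemma qadd0 : left_id qzero qadd.
Proof. by move=> p; rewrite -(qreprK p) qaddE add0r. Qed.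
Lemma qaddN : left_inverse qzero qopp qadd.
Proof. by move=> p; rewrite -(qreprK p) qoppE qaddE addNr. Qed.

HB.instance Definition _ := GRing.isZmodule.Build quot qaddA qaddC qadd0 qaddN.

Lemma qscaleA c d q : qscale c (qscale d q) = qscale (c * d) q.
Proof. by rewrite -(qreprK q) !qscaleE scalerA. Qed.
Lemma qscale1 : left_id 1 qscale.
Proof. by move=> q; rewrite -(qreprK q) qscaleE scale1r. Qed.
Lemma qscaleDr : right_distributive qscale +%R.
Proof.
move=> c p q; rewrite -[LHS]/(qscale c (qadd p q)).
rewrite -[RHS]/(qadd (qscale c p) (qscale c q)).
by rewrite -(qreprK p) -(qreprK q) qaddE !qscaleE qaddE scalerDr.
Qed.
Lemma qscaleDl q : {morph qscale^~ q : c d / c + d}.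
Proof.
move=> c d; rewrite -[RHS]/(qadd (qscale c q) (qscale d q)).
by rewrite -(qreprK q) !qscaleE qaddE scalerDl.
Qed.

HB.instance Definition _ :=
  GRing.Zmodule_isLmodule.Build R[i] quot qscaleA qscale1 qscaleDr qscaleDl.

Lemma qpiD x y : qpi (x + y) = qpi x + qpi y.
Proof. by rewrite -[RHS]/(qadd _ _) qaddE. Qed.

Lemma qpiZ c x : qpi (c *: x) = c *: qpi x.
Proof. by rewrite -[RHS]/(qscale _ _) qscaleE. Qed.

Lemma islin_qpi : islin qpi.
Proof. by move=> c x y; rewrite qpiD qpiZ. Qed.

Lemma qnormD p q : qnorm (p + q) <= qnorm p + qnorm q.
Proof.
rewrite -(qreprK p) -(qreprK q) -qpiD !qnormE -rmorphD lecR.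
exact: distD.
Qed.

Lemma qnormZ (c : R[i]) q : qnorm (c *: q) = `|c| * qnorm q.
Proof. by rewrite -(qreprK q) -qpiZ !qnormE distZ // rmorphM /= -rnormE. Qed.

Lemma qnorm0_eq0 q : qnorm q = 0 -> q = 0.
Proof.
rewrite -(qreprK q) qnormE => /(@complexI R) h.
rewrite -[RHS]/(qpi 0); apply: qpi_eq; rewrite subr0.
apply: dist_closed => //; exact: fc_closed.
Qed.

HB.instance Definition _ :=
  @Lmodule_isNormed.Build R[i] quot qnorm qnormD qnormZ qnorm0_eq0.

Lemma rnorm_qpi x : rnorm (qpi x) = dist J x.
Proof.
apply: (@complexI R); rewrite -rnormE; exact: qnormE.
Qed.

(** Completeness comes from finite codimension. In a basis modulo [J], the [i]-th coefficient is
    Lipschitz for the quotient norm, because [v i] has positive distance [de i] from the closed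
    subspace [N i] where that coefficient vanishes. *)
Lemma quot_complete (G : set_system quot) : ProperFilter G -> cauchy G -> cvg G.
Proof.
move=> GG /cauchyP Gc.
have [n cn] := fc_cod I.
have [m [v [_ sp ind]]] := cod_basis hI (@subspT _ L) (fun _ _ => Logic.I) cn.
have /choice[cf hcf] : forall z, exists c : 'rV[R[i]]_m,
    J (z - \sum_(i < m) c ord0 i *: v i) by move=> z; exact: sp.
pose N i : set L := [set z | exists2 c : 'rV[R[i]]_m, c ord0 i = 0 &
  J (z - \sum_(j < m) c ord0 j *: v j)].
have hN i : subsp (N i).
  split.
    exists 0; rewrite ?mxE // big1 ?subr0; last by move=> j _; rewrite mxE scale0r.
    exact: subsp0.
  move=> c z w [b bi hb] [d di hd]; exists (c *: b + d).
    by rewrite !mxE bi di mulr0 addr0.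
  rewrite (_ : _ - _ = c *: (z - \sum_(j < m) b ord0 j *: v j) +
      (w - \sum_(j < m) d ord0 j *: v j)); first exact: subspL.
  rewrite scalerBr addrACA -opprD scaler_sumr -big_split /=; congr (_ - _).
  by apply: eq_bigr => j _; rewrite !mxE scalerDl scalerA.
have IN i : J `<=` N i.
  move=> z Iz; exists 0; rewrite ?mxE // big1 ?subr0 //.
  by move=> j _; rewrite mxE scale0r.
have cN i : closed (N i).
  exact: (closed_subsp hI (@fc_closed _ _ I) cn (hN i) (IN i)).
have sumB (b d : 'rV[R[i]]_m) : \sum_(j < m) (b - d) ord0 j *: v j =
    \sum_(j < m) b ord0 j *: v j - \sum_(j < m) d ord0 j *: v j.
  by rewrite -sumrB; apply: eq_bigr => j _; rewrite !mxE scalerBl.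
have sum1 i k : \sum_(j < m) (k *: delta_mx ord0 i : 'rV[R[i]]_m) ord0 j *: v j = k *: v i.
  rewrite (bigD1 i) //= big1 ?addr0 ?mxE ?eqxx ?mulr1 // => j ji.
  by rewrite !mxE (negPf ji) andbF mulr0 scale0r.
pose de i := dist (N i) (v i).
have de0 i : 0 < de i.
  rewrite lt_def dist_ge0 // andbT; apply/eqP => /(dist_closed (hN i) (cN i)).
  case=> c ci; rewrite -(scale1r (v i)) -sum1 -sumB => /ind /rowP /(_ i).
  by rewrite !mxE ci !eqxx mulr1 subr0 => /eqP; rewrite oner_eq0.
have cfB i z w : rnorm (cf z ord0 i - cf w ord0 i) <= dist J (z - w) / de i.
  rewrite ler_pdivlMr // -distZ //.
  apply: le_trans (dist_anti (z - w) _ (IN i)); last by exists 0; exact: subsp0.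
  set k := cf z ord0 i - cf w ord0 i.
  rewrite -[X in _ <= dist _ X](subrKC (k *: v i)) dist_in //.
  exists (cf z - cf w - k *: delta_mx ord0 i).
    by rewrite !mxE !eqxx mulr1 subrr.
  set A := \sum_(j < m) cf z ord0 j *: v j.
  set B := \sum_(j < m) cf w ord0 j *: v j.
  rewrite 2!sumB sum1 -/A -/B opprB addrA subrK.
  rewrite (_ : z - w - (A - B) = (z - A) - (w - B)); first exact: subspB.
  by rewrite opprD addrACA [in RHS]opprD.
have Gball : forall e : {e : R | 0 < e}, exists q, G (ball q (sval e)%:C).
  by case=> e e0; apply: Gc; rewrite ltcR.
have [qs hqs] := choice Gball.
(* Each [(de i)^-1] occurs twice because [complex_cauchy] doubles the radius. *)
pose K := \sum_(i < m) ((de i)^-1 + (de i)^-1) * rnorm (v i).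
have dqs (e e' : {e : R | 0 < e}) :
    dist J (qrepr (qs e) - qrepr (qs e')) <= sval e + sval e'.
  have [q []] := filter_ex (filterI (hqs e) (hqs e')).
  rewrite -!ball_normE /= !rnormE !ltcR => h1 h2.
  rewrite -rnorm_qpi (islinB _ _ islin_qpi) !qreprK -(subrKA q).
  by rewrite (le_trans (rnormD _ _)) // lerD ?ltW // -rnormN opprB.
have /choice[l hl] : forall i : 'I_m, exists l, forall e : {e : R | 0 < e},
    rnorm (l - cf (qrepr (qs e)) ord0 i) <= sval e / de i + sval e / de i.
  move=> i; apply: (@complex_cauchy R _ (exist (fun e : R => is_true (0 < e)) 1 ltr01)) => e e'.
  apply: (le_trans (cfB _ _ _)); rewrite -mulrDl ler_pM2r ?invr_gt0 //.
have K0 : 0 <= K.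
  apply: sumr_ge0 => i _; rewrite mulr_ge0 ?rnorm_ge0 // addr_ge0 // invr_ge0 ltW //.
pose z := \sum_(i < m) l i *: v i.
have dz (e : {e : R | 0 < e}) : dist J (z - qrepr (qs e)) <= sval e * K.
  set w := qrepr (qs e).
  have := hcf w; set c := cf w => hw.
  rewrite -[X in dist _ X](subrKA (\sum_(i < m) c ord0 i *: v i)).
  rewrite -(opprB w) dist_in //; last exact: subspN.
  apply: (le_trans (dist_norm hI _)).
  rewrite /z -sumrB mulr_sumr; elim/big_ind2: _ => [|x1 y1 x2 y2 h1 h2|i _].
  - by rewrite rnorm0.
  - by apply: (le_trans (rnormD _ _)); exact: lerD.
  - rewrite -scalerBl rnormZ mulrA ler_wpM2r ?rnorm_ge0 // mulrDr.
    exact: hl.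
apply/cvg_ex; exists (qpi z); apply/cvgrPdist_le => eps eps0.
have epsE : eps = (complex.Re eps)%:C by rewrite RRe_real // gtr0_real.
(* The limit is within [e * K] of [qs e] and [q] is within [e] of it, so [e * (K + 1)] has to be
   [eps]. *)
have e0 : 0 < complex.Re eps / (K + 1).
  by rewrite divr_gt0 ?ltr_wpDl // -ltcR -epsE.
pose e := exist (fun e : R => is_true (0 < e)) _ e0.
apply: filterS (hqs e) => q; rewrite -ball_normE /= rnormE ltcR => hq.
rewrite epsE rnormE lecR -(subrKA (qs e)) (le_trans (rnormD _ _)) //.
have h1 : rnorm (qpi z - qs e) <= sval e * K.
  by rewrite -{1}(qreprK (qs e)) -(islinB _ _ islin_qpi) rnorm_qpi.
apply: (le_trans (lerD h1 (ltW hq))).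
rewrite -[X in _ + X]mulr1 -mulrDr /= divfK // gt_eqF // ltr_wpDl //.
Qed.

HB.instance Definition _ := Uniform_isComplete.Build quot quot_complete.

Lemma qlie_linearl (c : R[i]) (p p' q : quot) :
  qlie (c *: p + p') q = c *: qlie p q + qlie p' q.
Proof.
rewrite -(qreprK p) -(qreprK p') -(qreprK q) -qpiZ -qpiD !qlieE.
by rewrite -qpiZ -qpiD lie_linearl.
Qed.

Lemma qlie_linearr (c : R[i]) (p q q' : quot) :
  qlie p (c *: q + q') = c *: qlie p q + qlie p q'.
Proof.
rewrite -(qreprK p) -(qreprK q) -(qreprK q') -qpiZ -qpiD !qlieE.
by rewrite -qpiZ -qpiD lie_linearr.
Qed.

Lemma qliexx (p : quot) : qlie p p = 0.
Proof. by rewrite -(qreprK p) qlieE liexx. Qed.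

Lemma qlie_jacobi (p q r : quot) :
  qlie p (qlie q r) + qlie q (qlie r p) + qlie r (qlie p q) = 0.
Proof.
rewrite -(qreprK p) -(qreprK q) -(qreprK r) !qlieE -!qpiD.
by rewrite lie_jacobi.
Qed.

Lemma le_mul_dist (F : set L) (z : L) (c d : R) : F !=set0 -> 0 <= c ->
  (forall f, F f -> d <= c * rnorm (z - f)) -> d <= c * dist F z.
Proof.
move=> F0; rewrite le_eqVlt => /predU1P[<-|c0] h.
  by have [f /h] := F0; rewrite !mul0r.
rewrite mulrC -ler_pdivrMr //; apply: dist_ge => // f /h.
by rewrite ler_pdivrMr // mulrC.
Qed.

(** A quotient inherits the very constant of [L], so that any family of quotients has bounded
    multiplication constants. *)
Lemma qlie_mult_constant (t : R) : mult_constant L t ->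
  forall p q : quot, `|qlie p q| <= t%:C * `|p| * `|q|.
Proof.
move=> [t0 ht] p q; rewrite -(qreprK p) -(qreprK q) qlieE !rnormE.
rewrite -!rmorphM lecR !rnorm_qpi.
have J0 : J !=set0 by exists 0; exact: subsp0.
apply: le_mul_dist => //; first by rewrite mulr_ge0 ?dist_ge0 // ltW.
move=> g Jg; rewrite mulrAC; apply: le_mul_dist => //.
  by rewrite mulr_ge0 ?rnorm_ge0 // ltW.
move=> f Jf; rewrite mulrAC.
have := ht (qrepr p - f) (qrepr q - g); rewrite !rnormE -!rmorphM lecR.
apply: le_trans.
rewrite -(dist_in hI _ (f := lie (qrepr p - f) (qrepr q - g) -
  lie (qrepr p) (qrepr q))).
  by rewrite subrKC dist_norm.
by apply: fc_lieB; rewrite addrAC subrr add0r; exact: subspN.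
Qed.

Lemma qlie_bounded : exists2 t : R, 0 < t &
  forall p q : quot, `|qlie p q| <= t%:C * `|p| * `|q|.
Proof.
by have [t t0 ht] := @lie_bounded R L; exists t => //; exact: qlie_mult_constant.
Qed.

HB.instance Definition _ := isBanachLie.Build R quot
  qlie_linearl qlie_linearr qliexx qlie_jacobi qlie_bounded.

Lemma qpi_lie x y : qpi (lie x y) = lie (qpi x) (qpi y).
Proof. by rewrite -[RHS]/(qlie _ _) qlieE. Qed.

End Quotient.

(** * Exponentials and maximal subalgebras *)

(** Subtracting [2 ^ n] times the value at [t] from the value at [2 * t] kills the top coefficient
    and multiplies the [i]-th by [2 ^ i - 2 ^ n], which is nonzero for [i < n]; induction on the
    degree then takes the place of a determinant. *)
Lemma subsp_vandermonde (K : numFieldType) (X : lmodType K) (P : set X)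
  (w : nat -> X) n : subsp P ->
  (forall t : K, P (\sum_(i < n) t ^+ i *: w i)) -> forall i, (i < n)%N -> P (w i).
Proof.
move=> hP; elim: n w => [//|n IH] w H.
have Pw i : (i < n)%N -> P (w i).
  move=> ltin; have d0 : (2 ^+ i - 2 ^+ n : K) != 0.
    by rewrite subr_eq0 -!natrX eqr_nat eqn_exp2l // ltn_eqF.
  apply: (subspZ_inv d0 hP); apply: (IH (fun i => (2 ^+ i - 2 ^+ n) *: w i)) => // t.
  rewrite (_ : \sum_(i < n) _ = \sum_(i < n.+1) (2 * t) ^+ i *: w i -
      2 ^+ n *: \sum_(i < n.+1) t ^+ i *: w i).
    by apply: (subspB hP); [exact: H|apply: (subspZ _ hP); exact: H].
  rewrite !big_ord_recr /= scalerDr opprD addrACA scalerA -exprMn subrr addr0.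
  rewrite scaler_sumr -sumrB; apply: eq_bigr => j _.
  by rewrite !scalerA -scalerBl exprMn mulrBr mulrC (mulrC (t ^+ j)).
move=> i; rewrite ltnS leq_eqVlt => /predU1P[->|]; last exact: Pw.
have := H 1; rewrite big_ord_recr /= expr1n scale1r => h; apply: (subspDl hP _ h).
by apply: (subsp_sum _ hP) => j _; apply: (subspZ _ hP); exact: Pw.
Qed.

Lemma triangular_sum (V : zmodType) (g : nat -> nat -> V) n :
  (forall i j, (n <= i + j)%N -> g i j = 0) ->
  \sum_(0 <= s < n) \sum_(0 <= i < s.+1) g i (s - i)%N =
  \sum_(0 <= i < n) \sum_(0 <= j < n) g i j.
Proof.
move=> g0.
transitivity (\sum_(0 <= i < n) \sum_(0 <= j < n - i) g i j).
  clear g0; elim: n => [|n IH]; first by rewrite !big_nil.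
  rewrite big_nat_recr //= IH big_nat_recr //= [in RHS]big_nat_recr //=.
  rewrite subSnn big_nat1 subnn addrA; congr (_ + _).
  rewrite -big_split /= big_nat_cond [RHS]big_nat_cond.
  apply: eq_bigr => i /andP[/andP[_ ltin] _].
  by rewrite (subSn (ltnW ltin)) [RHS]big_nat_recr.
rewrite big_nat_cond [RHS]big_nat_cond.
apply: eq_bigr => i /andP[/andP[_ ltin] _].
rewrite [RHS](big_cat_nat (n := (n - i)%N)) //=; last exact: leq_subr.
rewrite [X in _ + X]big_nat_cond [X in _ + X]big1 ?addr0 // => j /andP[/andP[h _] _].
by apply: g0; rewrite addnC -leq_subLR -?subn0; lia.
Qed.

Definition maxsub (R : realType) (L : banachLieType R) : set (set L) :=
  maximal_in [set N | lie_subalgebra N /\ proper_set N].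

Lemma lie_subalgebra_preim (R : realType) (A B : banachLieType R) (phi : A -> B)
  (N : set B) : islin phi -> (forall x y, phi (lie x y) = lie (phi x) (phi y)) ->
  lie_subalgebra N -> lie_subalgebra (phi @^-1` N).
Proof.
move=> pl ph [hN NN]; split; first exact: (subsp_preim pl hN).
by move=> x y Nx Ny; rewrite /preimage /= ph; exact: NN.
Qed.

Lemma lie_subalgebra_image (R : realType) (A B : banachLieType R) (phi : A -> B)
  (N : set A) : islin phi -> (forall x y, phi (lie x y) = lie (phi x) (phi y)) ->
  lie_subalgebra N -> lie_subalgebra (phi @` N).
Proof.
move=> pl ph [hN NN]; split; last first.
  by move=> _ _ [x Nx <-] [y Ny <-]; exists (lie x y) => //; exact: NN.
split; first by exists 0; [exact: (subsp0 hN)|exact: islin0].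
move=> c _ _ [x Nx <-] [y Ny <-]; exists (c *: x + y) => //.
exact: (subspL c hN).
Qed.

Lemma maxsub_preim (R : realType) (A B : banachLieType R) (phi : A -> B)
  (N : set B) : islin phi -> (forall x y, phi (lie x y) = lie (phi x) (phi y)) ->
  (forall y, exists x, phi x = y) -> maxsub N -> maxsub (phi @^-1` N).
Proof.
move=> pl ph ps [[Nalg Np] Nmax]; split.
  split; first exact: lie_subalgebra_preim.
  move=> E; apply: Np; apply/seteqP; split=> // y _; have [x <-] := ps y.
  by have : (phi @^-1` N) x by rewrite E.
move=> N' [N'alg N'p] NN'; apply/seteqP; split=> // x N'x.
have [hN' _] := N'alg; have [hN _] := Nalg.
have ker y : phi y = 0 -> N' y.
  by move=> y0; apply: NN'; rewrite /preimage /= y0; exact: (subsp0 hN).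
have <- : phi @` N' = N; last by exists x.
apply: Nmax; last first.
  by move=> y Ny; have [z zy] := ps y; exists z => //; apply: NN'; rewrite /preimage /= zy.
split; first exact: lie_subalgebra_image.
move=> E; apply: N'p; apply/seteqP; split=> // y _.
have : (phi @` N') (phi y) by rewrite E.
case=> z N'z zy; rewrite -(subrK z y); apply: (subspD hN') => //.
by apply: ker; rewrite (islinB _ _ pl) zy subrr.
Qed.

(** * The exponential of a nilpotent inner derivation *)

Section Exponential.
Context {R : realType} {L : banachLieType R} (a : L) (m : nat).
Hypothesis (anil : forall z, iter m (lie a) z = 0).

Let T (i : nat) (z : L) : L := (i`!%:R^-1 : R[i]) *: iter i (lie a) z.

Definition lie_exp (z : L) : L := \sum_(0 <= i < m) T i z.

Let T_lin i : islin (T i).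
Proof.
move=> c x y; rewrite /T (islin_iter i (islin_lie a)) scalerDr !scalerA.
by rewrite mulrC.
Qed.

Let T0 i z : (m <= i)%N -> T i z = 0.
Proof.
move=> mi; rewrite /T -(subnK mi) iterD anil.
by rewrite (islin0 (islin_iter _ (islin_lie a))) scaler0.
Qed.

Let TS i z : lie a (T i z) = i.+1%:R *: T i.+1 z.
Proof.
rewrite /T (islinZ _ _ (islin_lie a)) scalerA -iterS factS natrM invfM mulrA.
by rewrite mulfV ?pnatr_eq0 // mul1r.
Qed.

(** Divided powers remove the binomial coefficients; the induction splits [s.+1] as [i + (s.+1 - i)]
    in each term. *)
Let leibniz s z w :
  T s (lie z w) = \sum_(0 <= i < s.+1) lie (T i z) (T (s - i) w).
Proof.
elim: s => [|s IH]; first by rewrite big_nat1 /T fact0 invr1 !scale1r.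
have s0 : (s.+1%:R : R[i]) != 0 by rewrite pnatr_eq0.
apply: (scalerI s0); rewrite -TS IH (islin_sum _ _ _ (islin_lie a)).
under eq_bigr do rewrite lie_der !TS.
rewrite big_split /= scaler_sumr.
transitivity (\sum_(0 <= i < s.+2) (i%:R : R[i]) *: lie (T i z) (T (s.+1 - i) w) +
  \sum_(0 <= i < s.+2) ((s.+1 - i)%:R : R[i]) *: lie (T i z) (T (s.+1 - i) w)).
  congr (_ + _).
    rewrite [RHS]big_nat_recl //= scale0r add0r; apply: eq_bigr => i _.
    by rewrite (islinZ _ _ (islin_liel _)) subSS.
  rewrite [RHS]big_nat_recr //= subnn scale0r addr0.
  rewrite big_nat_cond [RHS]big_nat_cond; apply: eq_bigr => i /andP[/andP[_ h] _].
  by rewrite (islinZ _ _ (islin_lie _)) subSn.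
rewrite -big_split /= big_nat_cond [RHS]big_nat_cond.
apply: eq_bigr => i /andP[/andP[_ h] _].
by rewrite -scalerDl -natrD subnKC.
Qed.

Let exp_wide n z : (m <= n)%N -> lie_exp z = \sum_(0 <= i < n) T i z.
Proof.
move=> mn; rewrite [RHS](big_cat_nat (n := m)) //= [X in _ + X]big_nat_cond.
rewrite [X in _ + X]big1 ?addr0 // => i /andP[/andP[h _] _].
exact: T0.
Qed.

Lemma islin_lie_exp : islin lie_exp.
Proof.
move=> c x y; rewrite /lie_exp scaler_sumr -big_split /=.
by apply: eq_bigr => i _; rewrite T_lin.
Qed.

Lemma lie_exp_lie z w : lie_exp (lie z w) = lie (lie_exp z) (lie_exp w).
Proof.
(* With [m + m] terms, [m + m <= i + j] forces [m <= i] or [m <= j], so the product of the series is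
   a full square sum. *)
have mm : (m <= m + m)%N by exact: leq_addr.
rewrite !(exp_wide _ mm).
under eq_bigr do rewrite leibniz.
rewrite (@triangular_sum _ (fun i j => lie (T i z) (T j w))); last first.
  move=> i j ij; have [mi|im] := leqP m i.
    by rewrite T0 // (islin0 (islin_liel _)).
  by rewrite [T j w]T0 ?(islin0 (islin_lie _)) //; lia.
rewrite (islin_sum _ _ _ (islin_liel _)); apply: eq_bigr => i _.
by rewrite (islin_sum _ _ _ (islin_lie _)).
Qed.

(** On the range of [(ad a)^p] the exponential is the identity up to the range of [(ad a)^(p + 1)],
    so surjectivity descends from [p = m], where this range is zero, to [p = 0]. *)
Lemma lie_exp_surj y : exists x, lie_exp x = y.
Proof.
suff H k : (k <= m)%N -> forall z, exists x, lie_exp x = iter (m - k) (lie a) z.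
  by have := H m (leqnn m) y; rewrite subnn.
elim: k => [_ z|k IH km z].
  by exists 0; rewrite (islin0 islin_lie_exp) subn0 anil.
have {}IH := IH (ltnW km).
set p := (m - k.+1)%N; have pE : (m - k)%N = p.+1 by rewrite /p subnSK.
rewrite pE in IH.
have m0 : (0 < m)%N by exact: leq_ltn_trans km.
pose q := \sum_(1 <= i < m) (i`!%:R^-1 : R[i]) *: iter i.-1 (lie a) z.
have [x hx] := IH q.
exists (iter p (lie a) z - x); rewrite (islinB _ _ islin_lie_exp) hx.
rewrite /lie_exp big_ltn // {1}/T fact0 invr1 scale1r /=.
rewrite (_ : \sum_(1 <= i < m) _ = lie a (iter p (lie a) q)) ?addrK //.
rewrite -iterS /q (islin_sum _ _ _ (islin_iter _ (islin_lie a))).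
rewrite big_nat_cond [RHS]big_nat_cond; apply: eq_bigr => i /andP[/andP[i0 _] _].
rewrite (islinZ _ _ (islin_iter _ (islin_lie a))) /T -!iterD.
by congr (_ *: iter _ _ _); lia.
Qed.

End Exponential.

Definition frattini (R : realType) (L : banachLieType R) : set L :=
  \bigcap_(N in @maxsub R L) N.

Lemma subsp_frattini (R : realType) (L : banachLieType R) : subsp (@frattini R L).
Proof.
split=> [N [[[hN _] _] _]|c x y hx hy N mN]; first exact: (subsp0 hN).
have [[[hN _] _] _] := mN.
by apply: (subspL c hN); [exact: hx|exact: hy].
Qed.

(** Preimages of maximal subalgebras under the automorphisms [exp (t ad a)] are maximal, so
    [exp (t ad a) p] stays in the intersection for every scalar [t]. It is polynomial in [t], with
    [lie a p] as linear coefficient. *)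
Lemma frattini_nilp (R : realType) (L : banachLieType R) (a : L) m :
  (forall z, iter m (lie a) z = 0) -> maps (lie a) (@frattini R L) (@frattini R L).
Proof.
move=> anil p Pp; have hP := @subsp_frattini R L.
pose w i := (i`!%:R^-1 : R[i]) *: iter i (lie a) p.
case: m anil => [|[|m]] anil.
- by rewrite -[lie a p]/(iter 0 (lie a) (lie a p)) anil; exact: subsp0.
- by rewrite -[lie a p]/(iter 1 (lie a) p) anil; exact: subsp0.
suff : frattini (w 1%N) by rewrite /w invr1 scale1r.
apply: (subsp_vandermonde (n := m.+2) hP) => // t N mN.
have itZ i z : iter i (lie (t *: a)) z = t ^+ i *: iter i (lie a) z.
  elim: i => [|i IH]; first by rewrite scale1r.
  rewrite !iterS IH (islinZ _ _ (islin_liel _)) (islinZ _ _ (islin_lie a)).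
  by rewrite scalerA -exprS.
have tnil z : iter m.+2 (lie (t *: a)) z = 0 by rewrite itZ anil scaler0.
have := maxsub_preim (@islin_lie_exp _ _ (t *: a) m.+2) (lie_exp_lie tnil)
  (lie_exp_surj tnil) mN.
move=> /Pp; rewrite /preimage /= /lie_exp big_mkord.
rewrite (eq_bigr (fun i : 'I_m.+2 => t ^+ i *: w i)) // => i _.
by rewrite itZ scalerA mulrC -scalerA.
Qed.

Lemma closed_zero (R : realType) (X : normedModType R[i]) : closed [set 0 : X].
Proof.
move=> x cx; have h0 : subsp [set 0 : X] by exact: subsp_set0.
have := closure_dist h0 cx => d0.
have [f -> hf] : exists2 f, [set 0 : X] f & rnorm (x - f) <= 0.
  exists 0 => //; rewrite -d0; apply: dist_ge; first by exists 0.
  by move=> f ->.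
by apply: rnorm_eq0; apply/eqP; rewrite eq_le rnorm_ge0 -{1}(subr0 x) hf.
Qed.

(** * The intersection of the maximal subalgebras of a subsimple algebra *)

Section SubsimpleFrattini.
Context {R : realType} {L : banachLieType R}.
Hypothesis (fdL : exists n, cod n [set 0 : L] setT).

Section Roots.
Variable x : L.

Definition root_space (mu : R[i]) : set L := geneig (lie x) [set 0] setT mu.

Lemma root_space_lie lam mu b z : root_space lam b -> root_space mu z ->
  root_space (lam + mu) (lie b z).
Proof.
move=> [_ [p pb]] [_ [q qz]]; split=> //; exists (p + q)%N.
suff : iter (p + q) (shift_op (lie x) (lam + mu)) (lie b z) = 0 by [].
have s0 nu k : iter k (shift_op (lie x) nu) 0 = 0.
  exact: (islin0 (islin_iter k (islin_shift nu (islin_lie x)))).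
elim: p q b z pb qz => [|p IHp] q b z.
  by move=> pb _; rewrite [b]pb (islin0 (islin_liel z)) s0.
elim: q z => [|q IHq] z pb.
  by move=> qz; rewrite [z]qz (islin0 (islin_lie b)) s0.
move=> qz; rewrite addSn iterSr.
have -> : shift_op (lie x) (lam + mu) (lie b z) =
    lie (shift_op (lie x) lam b) z + lie b (shift_op (lie x) mu z).
  rewrite /shift_op lie_der lieDl lieDr (islinN _ (islin_liel z)).
  rewrite (islinN _ (islin_lie b)) (islinZ _ _ (islin_liel z)).
  by rewrite (islinZ _ _ (islin_lie b)) addrACA -opprD -scalerDl.
rewrite (islinD _ _ (islin_iter _ (islin_shift _ (islin_lie x)))).
have -> : iter (p + q.+1) (shift_op (lie x) (lam + mu))
    (lie (shift_op (lie x) lam b) z) = 0.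
  by apply: IHp; rewrite // -iterSr.
rewrite add0r -addSnnS.
by apply: IHq => //; rewrite -iterSr.
Qed.

Lemma root_space_decomp (Z : set L) : subsp Z ->
  (forall mu, root_space mu `<=` Z) -> forall z, Z z.
Proof.
move=> hZ rZ z; have [n cn] := fdL.
have h0 : maps (lie x) [set 0] [set 0] by move=> _ ->; exact: (islin0 (islin_lie x)).
exact: (geneig_decomp (islin_lie x) (@subsp_set0 _ L) (@subspT _ L)
  (fun _ _ => I) h0 (fun _ _ => I) cn hZ rZ).
Qed.

(* [ad b] shifts the eigenvalues of [ad x] by [lam], and these are bounded. *)
Lemma root_space_nilp lam b : lam != 0 -> root_space lam b ->
  exists N, forall z, iter N (lie b) z = 0.
Proof.
move=> lam0 rb; have [C specC] := bounded_spectrum x.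
have big0 mu z : C < rnorm mu -> root_space mu z -> z = 0.
  move=> Cmu [_ [m]]; elim: m z => [//|m IH] z; rewrite iterSr => /IH.
  apply: (specC [set 0] (@subsp_set0 _ L) (@closed_zero _ L)) => //.
  by move=> _ ->; exact: (islin0 (islin_lie x)).
have l0 : 0 < rnorm lam.
  rewrite lt_def rnorm_ge0 andbT; apply: contra_neq lam0; exact: rnorm_eq0.
have [N hN] : exists N : nat, C + C < N%:R * rnorm lam.
  exists (Num.bound ((`|C| + `|C|) / rnorm lam)).
  rewrite -ltr_pdivrMr //; apply: (le_lt_trans _ (archi_boundP _)).
    by rewrite ler_pM2r ?invr_gt0 // lerD // ler_norm.
  by rewrite divr_ge0 ?addr_ge0 ?rnorm_ge0.
exists N => z.
have il := islin_iter N (islin_lie b).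
apply: (root_space_decomp (Z := [set z | iter N (lie b) z = 0])).
  exact: (subsp_preim il (@subsp_set0 _ L)).
move=> mu w rw; have [Cmu|muC] := ltP C (rnorm mu).
  by rewrite /= (big0 _ _ Cmu rw) (islin0 il).
have H j : root_space (j%:R * lam + mu) (iter j (lie b) w).
  elim: j => [|j IH]; first by rewrite mul0r add0r.
  by rewrite iterS -natr1 mulrDl mul1r (addrC _ lam) -addrA; exact: root_space_lie.
apply: big0 (H N).
have := rnormD (N%:R * lam + mu) (- mu); rewrite addrK rnormN => h.
have e1 : rnorm (N%:R * lam) = N%:R * rnorm lam.
  by apply: (@complexI R); rewrite rmorphM /= -!rnormE normrM normr_nat rmorph_nat.
rewrite e1 in h; lra.
Qed.

Definition roots : set L := [set b | exists2 lam, lam != 0 & root_space lam b].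

Definition root_ideal : set L := [set y | forall Z : set L, subsp Z ->
  roots `<=` Z -> (forall b b', roots b -> roots b' -> Z (lie b b')) -> Z y].

Lemma subsp_root_ideal : subsp root_ideal.
Proof.
split=> [Z hZ _ _|c u v hu hv Z hZ Z1 Z2]; first exact: subsp0.
by apply: subspL => //; [exact: hu|exact: hv].
Qed.

Lemma roots_root_ideal : roots `<=` root_ideal.
Proof. by move=> b rb Z _ h _; exact: h. Qed.

Lemma lie_roots_root_ideal b b' : roots b -> roots b' -> root_ideal (lie b b').
Proof. by move=> rb rb' Z _ _ h; exact: h. Qed.

(** A bracket with a root leaves [roots] only if the eigenvalues cancel, and is then a bracket of
    two roots. For [[z, [b, b']]] with cancelling [b] and [b']: if [z] has eigenvalue 0, the Jacobi
    identity gives brackets of roots again; otherwise the result has the nonzero eigenvalue of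
    [z]. *)
Lemma root_ideal_ideal : lie_ideal root_ideal.
Proof.
have hJ := subsp_root_ideal.
split=> // z; apply: (root_space_decomp (Z := [set z | maps (lie z) root_ideal root_ideal])).
  split=> [y _|c u v hu hv y Jy]; first by rewrite (islin0 (islin_liel y)); exact: subsp0.
  by rewrite lie_linearl; apply: (subspL c hJ); [exact: hu|exact: hv].
move=> mu {}z rz.
have zroots b : roots b -> root_ideal (lie z b).
  move=> [lam lam0 rb]; have [s0|s0] := eqVneq (mu + lam) 0; last first.
    by apply: roots_root_ideal; exists (mu + lam) => //; exact: root_space_lie.
  apply: lie_roots_root_ideal; last by exists lam.
  by exists mu => //; apply: contra_neq lam0 => m0; rewrite m0 add0r in s0.
move=> y Jy; apply: (Jy (lie z @^-1` root_ideal)).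
- exact: (subsp_preim (islin_lie z) hJ).
- by move=> b rb; exact: zroots.
- move=> b b' [lam lam0 rb] [lam' lam0' rb'].
  have [s0|s0] := eqVneq (lam + lam') 0; last first.
    by apply: zroots; exists (lam + lam') => //; exact: root_space_lie.
  have [m0|m0] := eqVneq mu 0.
    rewrite m0 in rz; rewrite /preimage /= lie_der; apply: (subspD hJ).
      apply: lie_roots_root_ideal; last by exists lam'.
      by exists lam => //; rewrite -(add0r lam); exact: root_space_lie.
    apply: lie_roots_root_ideal; first by exists lam.
    by exists lam' => //; rewrite -(add0r lam'); exact: root_space_lie.
  apply: roots_root_ideal; exists mu => //.
  by rewrite -(addr0 mu) -s0; apply: root_space_lie => //; exact: root_space_lie.
Qed.

End Roots.

Lemma subsimple_frattini (M : set L) : maxsub M ->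
  (forall I : set L, lie_ideal I -> I `<=` M -> I = [set 0]) ->
  @frattini R L `<=` [set 0].
Proof.
move=> mM nI; have [[Malg Mp] Mmax] := mM.
set P := @frattini R L.
have hP : subsp P by exact: subsp_frattini.
have PM : P `<=` M by move=> p; apply.
have [hM MM] := Malg.
have [[x [mu [u [mu0 u0 hu]]]]|noeig] := pselect (exists (x : L) (mu : R[i]) (u : L),
    [/\ mu != 0, u <> 0 & shift_op (lie x) mu u = 0]); last first.
  rewrite (nI P) //; split=> // a p Pp.
  have [n cn] := fdL.
  have h0 : maps (lie a) [set 0] [set 0] by move=> _ ->; exact: (islin0 (islin_lie a)).
  have [[m hm]|[mu [u [mu0 _ nu hu]]]] := nilp_or_eigenvector (islin_lie a)
      (@subsp_set0 _ L) (@subspT _ L) (fun _ _ => I) h0 (fun _ _ => I) cn.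
    by apply: (frattini_nilp (m := m)) Pp => z; exact: hm.
  by exfalso; apply: noeig; exists a, mu, u.
pose J := root_ideal x.
have Jid : lie_ideal J by exact: root_ideal_ideal.
have ru : roots x u by exists mu => //; split=> //; exists 1%N.
have [y Jy nMy] : exists2 y, J y & ~ M y.
  apply: contrapT => H; apply: u0.
  have : J u by exact: roots_root_ideal.
  rewrite (nI J) // => y Jy; apply: contrapT => nMy; apply: H; by exists y.
have JP : J `<=` idealizer P.
  have [hS SS] := idealizer_subalgebra hP.
  have rS : roots x `<=` idealizer P.
    move=> b [lam lam0 rb]; have [N hN] := root_space_nilp lam0 rb.
    exact: frattini_nilp hN.
  by move=> z; apply=> // b b' /rS rb /rS rb'; exact: SS.
(* The largest [J]-stable subspace of [M]. It is stable under [M], which normalises [J], and under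
   [y], which lies outside [M], so its idealizer is everything. As [J] preserves [P], it contains
   [P]. *)
pose Z : set L := [set z | forall k, lfil M J k z].
have hZ : subsp Z.
  split=> [k|c v w hv hw k]; first exact: (subsp0 (subsp_lfil J k hM)).
  by apply: (subspL c (subsp_lfil J k hM)); [exact: hv|exact: hw].
have MZ z : M z -> maps (lie z) Z Z.
  move=> Mz w Zw k; apply: lfil_stable => //; first by move=> v; exact: MM.
  by case: Jid => _ h v; exact: h.
have JZ z : J z -> maps (lie z) Z Z by move=> Jz w Zw k; have [_] := Zw k.+1; apply.
have Zid : lie_ideal Z.
  apply: lie_ideal_of_idealizer => //; apply: contrapT => np.
  have E : idealizer Z = M.
    by apply: Mmax; [split=> //; exact: idealizer_subalgebra|exact: MZ].
  by apply: nMy; rewrite -E; exact: JZ.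
rewrite -(nI Z) //; last by move=> z /(_ 0%N).
move=> p Pp k; elim: k p Pp => [|k IH] p Pp; first exact: PM.
by split=> [|b Jb]; apply: IH => //; exact: (JP b Jb).
Qed.

End SubsimpleFrattini.

(** * Subdirect products *)

Section FiniteCodimension.
Context {R : realType} {L : banachLieType R}.
Implicit Types M N : set L.

Lemma finite_codim_cod M : finite_codim M -> exists n, cod n M setT.
Proof.
move=> [n [v hv]]; exists n; apply: (cod_span (v := v)) => z _.
by have [c [Mc _]] := hv z; exists c.
Qed.

Lemma cod_finite_codim M n : subsp M -> cod n M setT -> finite_codim M.
Proof.
move=> hM cM; have [m [v [_ sp ind]]] := cod_basis hM (@subspT _ L) (fun _ _ => I) cM.
exists m, v => x; have [c Mc] := sp x I; exists c; split=> // d Md.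
apply/eqP; rewrite -subr_eq0; apply/eqP; apply: ind.
rewrite (_ : \sum_(i < m) _ = (x - \sum_(i < m) d ord0 i *: v i) -
   (x - \sum_(i < m) c ord0 i *: v i)); first exact: subspB.
rewrite opprB [RHS]addrC subrKA -sumrB.
by apply: eq_bigr => i _; rewrite !mxE scalerBl.
Qed.

Lemma finite_dim_cod : finite_dim L -> exists n, cod n [set 0 : L] setT.
Proof. exact: finite_codim_cod. Qed.

Lemma has_dim1 : has_dim L 1 ->
  exists2 v : L, v <> 0 & forall x, exists c : R[i], x = c *: v.
Proof.
move=> [v hv]; exists (v ord0) => [v0|x].
  have [c [_ uc]] := hv 0.
  have h (d : R[i]) : c = const_mx d.
    by apply: uc; rewrite big_ord1 v0 scaler0 subr0.
  have := h 0; rewrite (h 1) => /rowP/(_ ord0); rewrite !mxE => /eqP.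
  by rewrite oner_eq0.
have [c [h _]] := hv x; exists (c ord0 ord0).
by move: h; rewrite big_ord1 => /eqP; rewrite subr_eq0 => /eqP.
Qed.

Lemma has_dim1_subsp M : has_dim L 1 -> subsp M -> M = [set 0] \/ M = setT.
Proof.
move=> /has_dim1[v v0 hv] hM.
have [Mv|nMv] := pselect (M v).
  right; apply/seteqP; split=> // x _; have [c ->] := hv x; exact: subspZ.
left; apply/seteqP; split=> [x Mx|_ ->]; last exact: subsp0.
have [c xc] := hv x; have [c0|c0] := eqVneq c 0.
  by rewrite /= xc c0 scale0r.
by exfalso; apply: nMv; apply: (subspZ_inv c0 hM); rewrite -xc.
Qed.

End FiniteCodimension.

Section Epimorphism.
Context {R : realType} {A B : banachLieType R}.

Definition lie_epi (phi : A -> B) := [/\ islin phi,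
  forall x y, phi (lie x y) = lie (phi x) (phi y),
  forall y, exists x, phi x = y &
  exists k : R, forall x, rnorm (phi x) <= k * rnorm x].

Variable phi : A -> B.
Hypotheses (ephi : lie_epi phi) (fdB : finite_dim B).

Lemma lie_epi_preim (N : set B) : subsp N ->
  closed (phi @^-1` N) /\ finite_codim (phi @^-1` N).
Proof.
move=> hN; have [pl _ _ [k pk]] := ephi; have [n cn] := finite_dim_cod fdB.
have N0 : [set 0] `<=` N by move=> _ ->; exact: subsp0.
split.
  apply: (islin_closed_preim pl pk).
  by apply: (closed_subsp (@subsp_set0 _ B) (@closed_zero _ B) cn hN).
have cN : cod n N setT by exact: cod_sub cn.
have := cod_preim pl hN (@subspT _ A) cN; rewrite setTI.
exact: (cod_finite_codim (subsp_preim pl hN)).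
Qed.

(** Over a finite-dimensional [B] the preimage of a subspace is closed and of finite codimension, so
    maximality among all proper subalgebras yields the topological notion. *)
Lemma maxsub_preim_fc (N : set B) : maxsub N ->
  maximal_in (@closed_subalgebras_fc R A) (phi @^-1` N).
Proof.
move=> mN; have [pl ph ps _] := ephi.
have [[Nalg Np] Nmax] := maxsub_preim pl ph ps mN.
have [[[hN _] _] _] := mN; have [c f] := lie_epi_preim hN.
by split=> // N' [N'alg _ N'p _]; exact: Nmax.
Qed.

Lemma lie_ideal_preim (N : set B) : lie_ideal N -> lie_ideal (phi @^-1` N).
Proof.
have [pl ph _ _] := ephi => -[hN NN]; split; first exact: (subsp_preim pl hN).
by move=> x y Ny; rewrite /preimage /= ph; exact: NN.
Qed.

Lemma lie_ideal_image (N : set A) : lie_ideal N -> lie_ideal (phi @` N).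
Proof.
have [pl ph ps _] := ephi => Nid; have [_ NN] := Nid.
have [hi _] := lie_subalgebra_image pl ph (lie_idealW Nid).
split=> // b _ [y Ny <-]; have [x <-] := ps b.
by exists (lie x y); [exact: NN|exact: ph].
Qed.

Lemma lie_ideal_zero : lie_ideal [set 0 : B].
Proof. by split=> [|b _ ->]; [exact: subsp_set0|exact: (islin0 (islin_lie b))]. Qed.

Lemma kernel_maximal_ideal : (exists y : B, y <> 0) ->
  (forall I : set B, lie_ideal I -> I = [set 0] \/ I = setT) ->
  maximal_in (@closed_ideals_fc R A) (phi @^-1` [set 0]).
Proof.
move=> [y y0] simp; have [pl ph ps _] := ephi.
have [c f] := lie_epi_preim (@subsp_set0 _ B).
split.
  split=> //; first exact: (lie_ideal_preim lie_ideal_zero).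
  move=> E; have [x xy] := ps y; apply: y0; rewrite -xy.
  by have : (phi @^-1` [set 0]) x by rewrite E.
move=> N [Nid _ Np _] kN; have [hN _] := Nid.
have [E|E] := simp _ (lie_ideal_image Nid).
  apply/seteqP; split=> // x Nx.
  by rewrite -E; exists x.
exfalso; apply: Np; apply/seteqP; split=> // x _.
have : (phi @` N) (phi x) by rewrite E.
case=> z Nz zx; rewrite -(subrK z x); apply: (subspD hN) => //.
by apply: kN; rewrite /preimage /= (islinB _ _ pl) zx subrr.
Qed.

End Epimorphism.

Lemma quot_epi (R : realType) (L : banachLieType R) (I : fc_ideal L) :
  lie_epi (@qpi R L I).
Proof.
split; [exact: islin_qpi|exact: qpi_lie|by move=> q; exists (qrepr q); exact: qreprK|].
exists 1 => x; rewrite mul1r rnorm_qpi; apply: dist_norm.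
by case: (fc_is_ideal I).
Qed.

Lemma qpi_eq0 (R : realType) (L : banachLieType R) (I : fc_ideal L) x :
  @qpi R L I x = 0 <-> fc_set I x.
Proof.
split=> [h|Ix].
  by have := @qpi_inj _ _ I x 0 h; rewrite subr0.
by rewrite -[RHS]/(@qpi _ _ I 0); apply: qpi_eq; rewrite subr0.
Qed.

Lemma quot_finite_dim (R : realType) (L : banachLieType R) (I : fc_ideal L) :
  finite_dim (quot I).
Proof.
have [n cn] := fc_cod I.
apply: (@cod_finite_codim _ _ _ n (@subsp_set0 _ _)).
have : cod n [set 0 : quot I] (@qpi _ _ I @` setT).
  by apply: (cod_image (@islin_qpi _ _ I) _ cn) => x; exact: (qpi_eq0 I x).2.
by apply: cod_sub => // q _; exists (qrepr q) => //; exact: qreprK.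
Qed.

Section Embedding.
Context {R : realType} {L : banachLieType R}.

(** The source of all three embeddings: only the set of ideals and the property of their quotients
    change. The map is a contraction because the norm of a class is at most that of its
    representative. *)
Lemma iso_of_ideals (Q : banachLieType R -> Prop) (S : set (fc_ideal L)) :
  (forall I, S I -> Q (quot I)) ->
  (forall x, (forall I : fc_ideal L, S I -> fc_set I x) -> x = 0) ->
  iso_to_subdirect_product_of Q L.
Proof.
move=> SQ sep; have [t t0 ht] := @lie_bounded R L.
have hI (I : fc_ideal L) : subsp (fc_set I) by case: (fc_is_ideal I).
have Fb : exists t : {I | S I} -> R,
    (forall l, mult_constant (quot (sval l)) (t l)) /\ has_ubound (range t).
  exists (fun _ => t); split; last by exists t => _ [_ _ <-].
  by move=> l; split=> //; apply: qlie_mult_constant; split.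
pose F := @BanachLieFamily R {I | S I} (fun l => quot (sval l) : banachLieType R) Fb.
exists F; split; first by move=> [I SI]; exact: SQ.
have thb x : exists M : R, forall l : fam_index F, `|qpi (sval l) x : F l| <= M%:C.
  exists (rnorm x) => l; rewrite rnormE lecR rnorm_qpi; exact: dist_norm.
pose th x : dprod F := DProd (thb x).
have thl : linear th.
  by move=> c x y; apply: dprod_eq => l /=; exact: islin_qpi.
pose theta : {linear L -> dprod F} :=
  HB.pack th (GRing.isLinear.Build R[i] L (dprod F) *:%R th thl).
have thlie x y : th (lie x y) = lie (th x) (th y).
  by apply: dprod_eq => l; exact: qpi_lie.
exists (range th); split.
  split.
    apply: lie_subalgebra_image => //; split=> //; exact: subspT.
  move=> l; apply/seteqP; split=> // q _.
  by exists (th (qrepr q)); [exists (qrepr q)|exact: qreprK].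
exists theta; split=> //.
- exists 1 => x; rewrite mul1r.
  apply: (@dnorm_leC _ F (th x)) => // l.
  rewrite rnormE rnormE lecR rnorm_qpi; exact: dist_norm.
- move=> x y xy; apply/eqP; rewrite -subr_eq0; apply/eqP; apply: sep => I SI.
  apply: qpi_inj.
  have := congr1 (fun a : dprod F => dcoord a (exist _ I SI)) xy.
  by [].
Qed.

(** What the converse directions retain of a subdirect product: bounded epimorphisms onto the
    factors that separate points. *)
Lemma iso_separated (Q : banachLieType R -> Prop) :
  iso_to_subdirect_product_of Q L ->
  exists (Lam : Type) (F : Lam -> banachLieType R) (phi : forall l, L -> F l),
    [/\ forall l, Q (F l), forall l, lie_epi (phi l) &
        forall x, (forall l, phi l x = 0) -> x = 0].
Proof.
move=> [F [QF [M [[_ Mp] [theta [[K hK] thlie thinj thM]]]]]].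
exists (fam_index F), F, (fun l x => dcoord (theta x) l); split=> //.
  move=> l; split.
  - by move=> c x y; rewrite linearP.
  - by move=> x y; rewrite thlie.
  - move=> y; have : (dproj l @` M) y by rewrite Mp.
    by rewrite -thM => -[_ [x _ <-] <-]; exists x.
  - exists K => x; have := le_trans (le_coord_norm (theta x) l) (hK x).
    by rewrite !rnormE -rmorphM lecR.
move=> x h; apply: thinj; rewrite linear0; apply: dprod_eq => l.
exact: h.
Qed.

End Embedding.

(** * The three characterisations *)

Section Characterisations.
Context {R : realType} (L : banachLieType R).

Lemma bigcap_eq0 (S : set (set L)) : (forall M, S M -> subsp M) ->
  (forall x, (\bigcap_(M in S) M) x -> x = 0) -> \bigcap_(M in S) M = [set 0].
Proof.
move=> hS h; apply/seteqP; split=> [x /h //|_ -> M SM].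
by apply: subsp0; exact: hS.
Qed.

(** An ideal of the quotient inside the image of [M] pulls back to an ideal inside [M], hence inside
    [I]; so the image of [M] is core-free. *)
Lemma subsimple_quot (M : set L) (I : fc_ideal L) :
  maximal_in (@closed_subalgebras_fc R L) M -> fc_set I `<=` M ->
  (forall J : set L, lie_ideal J -> J `<=` M -> J `<=` fc_set I) ->
  subsimple (quot I).
Proof.
move=> [[Malg Mcl Mp Mfc] Mmax] IM Imax.
have [hM _] := Malg; have [n cn] := finite_codim_cod Mfc.
have [pl ph ps _] := quot_epi I; split; first exact: quot_finite_dim.
have inM x : (@qpi _ _ I @` M) (qpi I x) -> M x.
  move=> [y My yx]; rewrite -(subrK y x); apply: (subspD hM) => //.
  by apply/IM/qpi_eq0; rewrite (islinB _ _ pl) yx subrr.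
right; exists (@qpi _ _ I @` M).
  split.
    split; first exact: lie_subalgebra_image.
    move=> E; apply: Mp; apply/seteqP; split=> // x _; apply: inM; by rewrite E.
  move=> N [Nalg Np] MN.
  have pN : lie_subalgebra (@qpi _ _ I @^-1` N) by exact: lie_subalgebra_preim.
  have MpN : M `<=` @qpi _ _ I @^-1` N by move=> x Mx; apply: MN; exists x.
  have cN : cod n (@qpi _ _ I @^-1` N) setT by exact: cod_sub cn.
  have E : @qpi _ _ I @^-1` N = M.
    apply: Mmax => //; split=> //.
    - by apply: (closed_subsp hM Mcl cn) => //; case: pN.
    - move=> E; apply: Np; apply/seteqP; split=> // q _; have [x <-] := ps q.
      by have : (@qpi _ _ I @^-1` N) x by rewrite E.
    - by apply: cod_finite_codim cN; case: pN.
  apply/seteqP; split=> // q Nq; have [x xq] := ps q; exists x => //.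
  by rewrite -E /preimage /= xq.
move=> J Jid JM; apply/seteqP; split=> [q Jq|_ ->]; last first.
  by case: Jid => hJ _; exact: (subsp0 hJ).
have [x xq] := ps q; rewrite -xq; apply/qpi_eq0.
apply: (Imax (@qpi _ _ I @^-1` J)).
- exact: (lie_ideal_preim (quot_epi I)).
- by move=> y Jy; apply: inM; exact: JM.
- by rewrite /preimage /= xq.
Qed.

Lemma sem_Smax : Sem (@P_Smax R) L <-> iso_to_subdirect_product_of (@subsimple R) L.
Proof.
split=> [SL|/iso_separated[Lam [F [phi [Fss ephi sep]]]]].
  apply: (iso_of_ideals (S := [set I | exists M, [/\
    maximal_in (@closed_subalgebras_fc R L) M, fc_set I `<=` M &
    forall J : set L, lie_ideal J -> J `<=` M -> J `<=` fc_set I]])).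
    by move=> I [M [mM IM Imax]]; exact: subsimple_quot mM IM Imax.
  move=> x hx; suff : @P_Smax R L x by rewrite SL.
  move=> M mM; have [[Malg Mcl Mp Mfc] Mmax] := mM; have [hM _] := Malg.
  have [n cn] := finite_codim_cod Mfc.
  have [||I [Iid Icl Ifc IM Imax]] := largest_ideal Malg Mcl _ Mp.
  - by exists n.
  - move=> N Nalg MN [u Nu nMu]; apply: contrapT => Np; apply: nMu.
    have hN : subsp N by case: Nalg.
    have cN : cod n N setT by exact: cod_sub cn.
    rewrite -(Mmax N) //; split=> //; first exact: (closed_subsp hM Mcl cn).
    exact: cod_finite_codim cN.
  - by apply/IM/(hx (FcIdeal Iid Icl Ifc)); exists M.
apply: bigcap_eq0 => [M [[[hM _] _ _ _] _] //|x Px].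
apply: sep => l; have [Ffd Fl] := Fss l.
suff : @frattini R (F l) `<=` [set 0].
  by apply=> N mN; exact: (Px _ (maxsub_preim_fc (ephi l) Ffd mN)).
case: Fl => [d1|[M mM nI]]; last first.
  exact: (subsimple_frattini (finite_dim_cod Ffd) mM nI).
(* In dimension one the zero subalgebra is itself maximal. *)
move=> y; apply; split.
  split; first exact: (lie_idealW lie_ideal_zero).
  move=> E; have [v v0 _] := has_dim1 d1; apply: v0.
  by have : [set 0 : F l] v by rewrite E.
by move=> N [[hN _] Np] _; have [//|/Np] := has_dim1_subsp d1 hN.
Qed.

Lemma simple_quot (I : fc_ideal L) :
  maximal_in (@closed_ideals_fc R L) (fc_set I) ->
  (lie_simple (quot I) /\ finite_dim (quot I)) \/ has_dim (quot I) 1.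
Proof.
move=> [[Iid Icl Ip Ifc] Imax]; have [pl ph ps _] := quot_epi I.
have [hI _] := Iid; have [n cn] := finite_codim_cod Ifc.
have simp (J : set (quot I)) : lie_ideal J -> J = [set 0] \/ J = setT.
  move=> Jid; have [->|JT] := pselect (J = setT); [by right|left].
  have pJ : lie_ideal (@qpi _ _ I @^-1` J) by exact: (lie_ideal_preim (quot_epi I)).
  have IJ : fc_set I `<=` @qpi _ _ I @^-1` J.
    move=> x /qpi_eq0 x0; rewrite /preimage /= x0.
    by case: Jid => hJ _; exact: (subsp0 hJ).
  have cJ : cod n (@qpi _ _ I @^-1` J) setT by exact: cod_sub cn.
  have E : @qpi _ _ I @^-1` J = fc_set I.
    apply: Imax => //; split=> //.
    - by apply: (closed_subsp hI Icl cn) => //; case: pJ.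
    - move=> E; apply: JT; apply/seteqP; split=> // q _; have [x <-] := ps q.
      by have : (@qpi _ _ I @^-1` J) x by rewrite E.
    - by apply: cod_finite_codim cJ; case: pJ.
  apply/seteqP; split=> [q Jq|_ ->]; last by case: Jid => hJ _; exact: (subsp0 hJ).
  have [x xq] := ps q; rewrite -xq; apply/qpi_eq0; rewrite -E /preimage /= xq.
  exact: Jq.
have [[a [b ab]]|nab] := pselect (exists a b : quot I, lie a b <> 0).
  by left; split; [split=> //; exists a, b|exact: quot_finite_dim].
right; have [x nIx] : exists x, ~ fc_set I x.
  apply: contrapT => H; apply: Ip; apply/seteqP; split=> // x _.
  by apply: contrapT => nIx; apply: H; exists x.
have v0 : qpi I x <> 0 by move=> /qpi_eq0.
have ab0 (a b : quot I) : lie a b = 0.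
  by apply: contrapT => h; apply: nab; exists a, b.
(* With zero bracket every line is an ideal, so this line is the whole quotient. *)
have vid : lie_ideal (adj [set 0] (qpi I x)).
  split; first exact: (subsp_adj _ (@subsp_set0 _ _)).
  move=> a b _; rewrite ab0; apply: subsp0; apply: subsp_adj; exact: subsp_set0.
have [E|E] := simp _ vid.
  exfalso; apply: v0; have := adj_gen (qpi I x) (@subsp_set0 _ (quot I)).
  by rewrite E.
exists (fun _ => qpi I x) => q.
have : adj [set 0] (qpi I x) q by rewrite E.
case=> c hc; exists (const_mx c); split; first by rewrite big_ord1 mxE.
move=> d hd; apply/rowP => i; rewrite mxE (ord1 i).
apply/eqP; rewrite -subr_eq0; apply/eqP; apply: contrapT => /eqP cd.
apply: v0; apply: (subspZ_inv cd (@subsp_set0 _ (quot I))).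
move: hd; rewrite big_ord1 => hd.
have -> : (c - d ord0 ord0) *: qpi I x =
    (q - d ord0 ord0 *: qpi I x) - (q - c *: qpi I x).
  by rewrite opprB [RHS]addrC subrKA scalerBl.
exact: (subspB (@subsp_set0 _ _) hd hc).
Qed.

Lemma sem_Jmax : Sem (@P_Jmax R) L <-> iso_to_subdirect_product_of
  (fun A : banachLieType R => (lie_simple A /\ finite_dim A) \/ has_dim A 1) L.
Proof.
split=> [SL|/iso_separated[Lam [F [phi [Fs ephi sep]]]]].
  apply: (iso_of_ideals
    (S := [set I | maximal_in (@closed_ideals_fc R L) (fc_set I)])).
    exact: simple_quot.
  move=> x hx; suff : @P_Jmax R L x by rewrite SL.
  move=> M mM; have [[Mid Mcl _ Mfc] _] := mM.
  exact: (hx (FcIdeal Mid Mcl (finite_codim_cod Mfc))).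
apply: bigcap_eq0 => [M [[[hM _] _ _ _] _] //|x Px].
apply: sep => l; apply: (Px (phi l @^-1` [set 0])).
case: (Fs l) => [[[[a [b ab]] simp] fd]|d1].
  by apply: (kernel_maximal_ideal (ephi l) fd) => //; exists (lie a b).
apply: (kernel_maximal_ideal (ephi l)); first by exists 1%N.
  by have [v v0 _] := has_dim1 d1; exists v.
by move=> J [hJ _]; exact: has_dim1_subsp.
Qed.

Lemma sem_J : Sem (@P_J R) L <-> iso_to_subdirect_product_of (@finite_dim R) L.
Proof.
split=> [SL|/iso_separated[Lam [F [phi [Ffd ephi sep]]]]].
  apply: (iso_of_ideals (S := [set I | @closed_ideals_fc R L (fc_set I)])).
    by move=> I _; exact: quot_finite_dim.
  move=> x hx; suff : @P_J R L x by rewrite SL.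
  move=> M mM; have [Mid Mcl _ Mfc] := mM.
  exact: (hx (FcIdeal Mid Mcl (finite_codim_cod Mfc))).
apply: bigcap_eq0 => [M [[hM _] _ _ _] //|x Px].
apply: sep => l; have [cl fc] := lie_epi_preim (ephi l) (Ffd l) (@subsp_set0 _ _).
(* The factor may be the zero algebra, whose kernel is not proper and so is not among the
   intersected ideals. *)
have [E|np] := pselect (phi l @^-1` [set 0] = setT).
  by have : (phi l @^-1` [set 0]) x by rewrite E.
apply: (Px (phi l @^-1` [set 0])); split=> //.
exact: (lie_ideal_preim (ephi l) lie_ideal_zero).
Qed.

End Characterisations.

Theorem theorem9p9 (R : realType) (L : banachLieType R) :
  [/\ Sem (@P_Smax R) L <->
        iso_to_subdirect_product_of (@subsimple R) L,
      Sem (@P_Jmax R) L <->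
        iso_to_subdirect_product_of
          (fun A : banachLieType R =>
             (lie_simple A /\ finite_dim A) \/ has_dim A 1) L
    & Sem (@P_J R) L <->
        iso_to_subdirect_product_of (@finite_dim R) L].
Proof. by split; [exact: sem_Smax|exact: sem_Jmax|exact: sem_J]. Qed.
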